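(* Let $\mathcal{A}$ be a complex unital $C^*$-algebra, let $a\in\mathcal{A}$ be a non-zero positive element, and let $0\le\alpha\le1$. Then the following hold. (a) If $x\in\mathcal{A}_a$ and $x^{\#_a}$ is an $a$-adjoint of $x$, then (i) $v_a^2(x)\le \frac{\alpha}{2}v_a(x^2)+\big\|\frac{\alpha}{4}xx^{\#_a}+(1-\frac{3\alpha}{4})x^{\#_a}x\big\|_a$; (ii) $v_a^2(x)\le \frac{\alpha}{2}v_a(x^2)+\big\|\frac{\alpha}{4}x^{\#_a}x+(1-\frac{3\alpha}{4})xx^{\#_a}\big\|_a$. (b) If $x\in\mathcal{A}$ and $\phi$ is an Orlicz function, then (i) $\phi\big(v^2(x)\big)\le \frac{\alpha}{2}\phi\big(v(x^2)\big)+\big\|\frac{\alpha}{4}\phi(xx^* )+(1-\frac{3\alpha}{4})\phi(x^*x)\big\|$; (ii) $\phi\big(v^2(x)\big)\le \frac{\alpha}{2}\phi\big(v(x^2)\big)+\big\|\frac{\alpha}{4}\phi(x^*x)+(1-\frac{3\alpha}{4})\phi(xx^* )\big\|$.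
   Context: $\mathbf 1$ is the unit of $\mathcal{A}$. A functional $f\in\mathcal{A}^*$ is positive ($f\ge 0$) if $f(x^*x)\ge 0$ for all $x\in\mathcal{A}$. $\mathcal{S}(\mathcal{A})=\{g\in\mathcal{A}^*: g\ge0,\ g(\mathbf 1)=1\}$ is the set of states and $v(x)=\sup\{|g(x)|: g\in\mathcal{S}(\mathcal{A})\}$ is the (algebraic) numerical radius. For a non-zero positive $a\in\mathcal{A}$: $\mathcal{S}_a(\mathcal{A})=\{f\in\mathcal{A}^*: f\ge0,\ f(a)=1\}$; the $a$-numerical radius is $v_a(x)=\sup\{|f(ax)|: f\in\mathcal{S}_a(\mathcal{A})\}$; and $\|x\|_a=\sup\{\sqrt{f(x^*ax)}: f\in\mathcal{S}_a(\mathcal{A})\}$ (possibly $+\infty$ in general, but finite on $\mathcal{A}_a$). An $a$-adjoint of $x\in\mathcal{A}$ is an element $x^{\#_a}\in\mathcal{A}$ with $ax^{\#_a}=x^*a$ (it need not exist or be unique); $\mathcal{A}_a$ is the set of all elements of $\mathcal{A}$ that have an $a$-adjoint. The notation $v_a^2(x)$ means $(v_a(x))^2$, and similarly for $v$. An Orlicz function is a map $\phi:[0,\infty)\to[0,\infty)$ that is continuous, convex, non-decreasing, with $\phi(0)=0$ and $\phi(u)\to\infty$ as $u\to\infty$; it is always assumed non-degenerate, i.e. $\phi(u)>0$ for $u>0$. For a positive element $y$, $\phi(y)$ is defined by continuous functional calculus. *)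

(* Defs.v *)
From HB Require Import structures.
From mathcomp Require Import all_boot all_order all_algebra.
From mathcomp Require Import complex.
From mathcomp Require Import all_classical all_reals all_analysis.

Set Implicit Arguments.
Unset Strict Implicit.
Unset Printing Implicit Defensive.

Import Order.TTheory GRing.Theory Num.Theory.
Import numFieldNormedType.Exports.

Local Open Scope classical_set_scope.
Local Open Scope complex_scope.
Local Open Scope ring_scope.

Definition cabs (R : realType) (c : R[i]) : R := complex.Re `|c|.

HB.mixin Record isCStarAlgebra (R : realType) A of GRing.Algebra R[i] A := {
  star : A -> A ;
  starK : involutive star ;
  starD : {morph star : x y / x + y} ;
  starZ : forall (c : R[i]) (x : A), star (c *: x) = c^* *: star x ;
  starM : forall x y : A, star (x * y) = star y * star x ;
  cnorm : A -> R ;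
  cnorm0_eq0 : forall x : A, cnorm x = 0 -> x = 0 ;
  cnormD : forall x y : A, cnorm (x + y) <= cnorm x + cnorm y ;
  cnormZ : forall (c : R[i]) (x : A), cnorm (c *: x) = cabs c * cnorm x ;
  cnormM : forall x y : A, cnorm (x * y) <= cnorm x * cnorm y ;
  cnorm_star : forall x : A, cnorm (star x * x) = cnorm x ^+ 2 ;
  cnorm_complete : forall u : nat -> A,
    (forall e : R, 0 < e -> exists N : nat, forall m n : nat,
       (N <= m)%N -> (N <= n)%N -> cnorm (u m - u n) < e) ->
    exists l : A, forall e : R, 0 < e -> exists N : nat, forall n : nat,
       (N <= n)%N -> cnorm (u n - l) < e
}.

(* Complex unital C*-algebras.  The norm is an operation of the mixin and not
   that of [normedModType R[i]]: Hierarchy Builder rejects a structure joining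
   [algType] and [normedModType], which would compete with [numDomainType]. *)
#[short(type="cstarAlgType")]
HB.structure Definition CStarAlgebra (R : realType) :=
  {A of GRing.Algebra R[i] A & isCStarAlgebra R A}.

Section CStar.
Context {R : realType} {A : cstarAlgType R}.
Implicit Types (a x y : A) (f : {linear A -> R[i]^o}) (g h : R[i] -> R[i]).

Definition positive a := exists z : A, a = star z * z.

Definition bounded_functional f :=
  exists M : R, forall x, cabs (f x) <= M * cnorm x.

(* The order of R[i] is the partial one: [0 <= c] means that [c] is real and
   nonnegative. *)
Definition positive_functional f :=
  bounded_functional f /\ forall x, 0 <= f (star x * x).

Definition a_states a : set {linear A -> R[i]^o} :=
  [set f | positive_functional f /\ f a = 1].

Definition states : set {linear A -> R[i]^o} := a_states 1.

Definition num_radius x : R := sup [set cabs (g x) | g in states].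

(* The suprema defining the a-numerical radius and the a-seminorm are taken in
   [0, +oo]: adjoining 0 only fixes the supremum of the empty set, and
   [a_states a] is nonempty when [a] is positive and non-zero. *)
Definition a_num_radius a x : \bar R :=
  ereal_sup (0%E |` [set (cabs (f (a * x)))%:E | f in a_states a]).

Definition a_norm a x : \bar R :=
  ereal_sup (0%E |`
    [set (Num.sqrt (complex.Re (f (star x * a * x))))%:E | f in a_states a]).

Definition a_adjoint a x y := a * y = star x * a.

Definition a_adjointable a : set A := [set x | exists y, a_adjoint a x y].

Definition invertible x := exists y, x * y = 1 /\ y * x = 1.

Definition spectrum y : set R[i] := [set l | ~ invertible (l *: 1 - y)].

(* R[i]^o carries the norm topology of the complex plane. *)
Definition continuous_on_spectrum y g :=
  {within (spectrum y : set R[i]^o), continuous (g : R[i]^o -> R[i]^o)}.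

(* [Phi] is a unital *-homomorphism from C(spectrum y) to A mapping the identity
   function to [y].  An element of C(spectrum y) is represented by any function
   on R[i] whose restriction to the spectrum is that element.  For a normal [y]
   there is exactly one such homomorphism, and it is isometric. *)
Record functional_calculus y (Phi : (R[i] -> R[i]) -> A) : Prop := {
  fcalc_ext : forall g h : R[i] -> R[i], continuous_on_spectrum y g ->
    {in spectrum y, g =1 h} -> Phi g = Phi h ;
  fcalc_id : Phi id = y ;
  fcalc1 : Phi (fun=> 1) = 1 ;
  fcalcD : forall g h : R[i] -> R[i], continuous_on_spectrum y g ->
    continuous_on_spectrum y h ->
    Phi (fun z => g z + h z) = Phi g + Phi h ;
  fcalcZ : forall (c : R[i]) (g : R[i] -> R[i]), continuous_on_spectrum y g ->
    Phi (fun z => c * g z) = c *: Phi g ;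
  fcalcM : forall g h : R[i] -> R[i], continuous_on_spectrum y g ->
    continuous_on_spectrum y h ->
    Phi (fun z => g z * h z) = Phi g * Phi h ;
  fcalc_star : forall g : R[i] -> R[i], continuous_on_spectrum y g ->
    Phi (fun z => (g z)^*) = star (Phi g)
}.

Definition cfc y (g : R[i] -> R[i]) : A :=
  xget 0 [set b | exists2 Phi, functional_calculus y Phi & b = Phi g].

(* phi(y) for a positive [y] and phi : [0, +oo[ -> [0, +oo[.  The values of
   [phi] on negative reals are irrelevant: the spectrum of [y] is contained in
   [0, +oo[, where clamping at 0 has no effect. *)
Definition cfc_nonneg y (phi : R -> R) : A :=
  cfc y (fun z => (phi (Num.max 0 (complex.Re z)))%:C).

End CStar.

(* An Orlicz function [0, +oo[ -> [0, +oo[, non-degenerate, given by a function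
   on R that is constrained only on [0, +oo[. *)
Record orlicz (R : realType) (phi : R -> R) : Prop := {
  orlicz_ge0 : forall u : R, 0 <= u -> 0 <= phi u ;
  orlicz_continuous : {within `[0, +oo[, continuous phi} ;
  orlicz_convex : convex_function (`[0, +oo[%classic : set R) phi ;
  orlicz_homo : forall u w : R, 0 <= u -> u <= w -> phi u <= phi w ;
  orlicz0 : phi 0 = 0 ;
  orlicz_cvg : phi u @[u --> +oo] --> +oo ;
  orlicz_gt0 : forall u : R, 0 < u -> 0 < phi u
}.

(* Main.v *)
(* Part (a).  For an a-state f and a = c* c, the sesquilinear form
   <y, z> = f(z* a y) is positive, and <x, 1> = f(ax) = <1, x#>.  Buzano's
   inequality |<x, 1><1, x#>| <= (|<x, x#>| + ||x|| ||x#||) / 2 bounds |f(ax)|^2;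
   averaging it, with weights alpha and 1 - alpha, against the Cauchy-Schwarz bound
   |f(ax)|^2 <= ||x||^2 gives the claim for f.

   Part (b).  For a = 1 the same bound is a convex combination of |f(x^2)|, f(xx* )
   and f(x*x), to which the convex function phi is applied.  Jensen's inequality
   phi(f(y)) <= f(phi(y)) follows from a supporting line of phi at f(y): the
   difference of phi and the line is the square of a continuous function.

   It remains to construct phi(y) for a self-adjoint y.  Square roots of 1 - h with
   ||h|| < 1 come from the contraction u |-> (h + u^2) / 2; they imply that the
   spectrum of y is real and that it contains ||y|| or - ||y||.  By spectral mapping
   ||p(y)|| is the maximum of |p| on the spectrum for every polynomial p, and
   Bernstein polynomials extend p |-> p(y) to continuous functions. *)

Require Import Defs.
From HB Require Import structures.
From mathcomp Require Import all_boot all_order all_algebra.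
From mathcomp Require Import complex.
From mathcomp Require Import all_classical all_reals all_analysis.
From mathcomp Require Import ring lra.

Import Order.TTheory GRing.Theory Num.Theory.
Import numFieldNormedType.Exports.
Local Open Scope classical_set_scope.
Local Open Scope complex_scope.
Local Open Scope ring_scope.

(** * The real-valued modulus on [R[i]] *)

Section ComplexModulus.
Context {R : realType}.
Implicit Types c d : R[i].

Lemma cabsE c : cabs c = Num.sqrt (complex.Re c ^+ 2 + complex.Im c ^+ 2).
Proof. by rewrite /cabs normc_def. Qed.

Lemma cabsC c : (cabs c)%:C = `|c|.
Proof. by rewrite cabsE normc_def. Qed.

Lemma cabs_ge0 c : 0 <= cabs c.
Proof. by rewrite cabsE sqrtr_ge0. Qed.

Lemma cabsM c d : cabs (c * d) = cabs c * cabs d.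
Proof. by apply: complexI; rewrite rmorphM /= !cabsC normrM. Qed.

Lemma cabsD c d : cabs (c + d) <= cabs c + cabs d.
Proof. by rewrite -lecR rmorphD /= !cabsC ler_normD. Qed.

Lemma cabsN c : cabs (- c) = cabs c.
Proof. by apply: complexI; rewrite !cabsC normrN. Qed.

Lemma cabs_conj c : cabs c^*%C = cabs c.
Proof. by rewrite !cabsE; case: c => x y /=; rewrite sqrrN. Qed.

Lemma cabsr (x : R) : cabs x%:C = `|x|.
Proof. by rewrite cabsE /= expr0n addr0 sqrtr_sqr. Qed.

Lemma cabs0 : cabs (0 : R[i]) = 0.
Proof. by rewrite -(normr0 R) -cabsr. Qed.

Lemma cabs_geRe c : `|complex.Re c| <= cabs c.
Proof. by rewrite -lecR cabsC normc_ge_Re. Qed.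

Lemma ge0_ReK c : 0 <= c -> (complex.Re c)%:C = c.
Proof. by move=> c0; rewrite RRe_real ?ger0_real. Qed.

Lemma ge0_Re_ge0 c : 0 <= c -> 0 <= complex.Re c.
Proof. by move=> c0; rewrite -ler0c ge0_ReK. Qed.

Lemma Re_le_cabs c : complex.Re c <= cabs c.
Proof. exact: le_trans (ler_norm _) (cabs_geRe c). Qed.

Lemma ReD c d : complex.Re (c + d) = complex.Re c + complex.Re d.
Proof. by case: c; case: d. Qed.

Lemma ReZ (x : R) c : complex.Re (x%:C * c) = x * complex.Re c.
Proof. by case: c => u v /=; rewrite mul0r subr0. Qed.

End ComplexModulus.

(** * Algebra of the involution *)

Section Star.
Context {R : realType} {A : cstarAlgType R}.
Implicit Types x y z : A.

Lemma star0 : star 0 = 0 :> A.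
Proof. by apply: (addrI (star 0)); rewrite -starD !addr0. Qed.

Lemma starN x : star (- x) = - star x.
Proof. by apply/eqP; rewrite -addr_eq0 -starD addNr star0. Qed.

Lemma starB x y : star (x - y) = star x - star y.
Proof. by rewrite starD starN. Qed.

Lemma star1 : star 1 = 1 :> A.
Proof. by rewrite -[LHS]mulr1 -[X in _ * X]starK -starM mulr1 starK. Qed.

Lemma starX x n : star (x ^+ n) = star x ^+ n.
Proof. by elim: n => [|n IH]; rewrite ?star1 // exprS starM IH exprSr. Qed.

Lemma starZC (c : R[i]) x : star (c *: x) = c^*%C *: star x.
Proof. exact: starZ. Qed.

Lemma starZr (t : R) x : star (t%:C *: x) = t%:C *: star x.
Proof. by rewrite starZC conjc_real. Qed.

End Star.

Lemma functionalZ {R : realType} {A : cstarAlgType R} (f : {linear A -> R[i]^o})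
  (c : R[i]) (x : A) : f (c *: x) = c * f x.
Proof. exact: linearZ_LR. Qed.

(** * Cauchy-Schwarz and Buzano inequalities *)

Section PositiveFunctional.
Context {R : realType} {A : cstarAlgType R} (f : {linear A -> R[i]^o}).
Hypothesis f_ge0 : forall x, 0 <= f (star x * x).
Implicit Types x y z p q e : A.

(** Polarization: [f (star u * u)] is real for [u] equal to [1], [x], [1 + x] and [1 + 'i *: x]; the
    vanishing imaginary parts determine both coordinates of [f (star x)]. *)
Lemma positive_functional_star x : f (star x) = (f x)^*%C.
Proof.
have Im_ge0 u : complex.Im (f (star u * u)) = 0 by exact: ger0_Im.
have := Im_ge0 (1 + x); have := Im_ge0 (1 + 'i *: x).
have := Im_ge0 1; have := Im_ge0 x.
rewrite !starD !starZC star1 !mulrDl !mulrDr !mul1r !mulr1.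
rewrite -!scalerAl -!scalerAr ?mul1r ?mulr1 scalerA.
have -> : 'i^*%C * 'i = 1 :> R[i].
  by apply/eqP; rewrite eq_complex /=; apply/andP; split; apply/eqP; ring.
rewrite scale1r !(linearD f) !functionalZ.
case: (f x) => a b; case: (f (star x)) => c d; case: (f 1) => a1 b1.
case: (f (star x * x)) => a2 b2 /= -> ->.
rewrite -!/(_ * _) /= => h1 h2.
congr (_ +i* _); lra.
Qed.

Lemma positive_functional_CS y z :
  cabs (f (star z * y)) ^+ 2
  <= complex.Re (f (star z * z)) * complex.Re (f (star y * y)).
Proof.
set w := f (star z * y); set a := complex.Re _; set b := complex.Re _.
have b0 : 0 <= b by exact: ge0_Re_ge0.
have key (s : R) : 0 <= a - 2 * s * cabs w ^+ 2 + s ^+ 2 * cabs w ^+ 2 * b.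
  have fzy : f (star y * z) = w^*%C.
    by rewrite -positive_functional_star starM starK.
  have E : f (star (z - (s%:C * w^*%C) *: y) * (z - (s%:C * w^*%C) *: y))
    = a%:C - (s%:C * w^*%C) * w
      - ((s%:C * w^*%C)^*%C * w^*%C
         - (s%:C * w^*%C)^*%C * ((s%:C * w^*%C) * b%:C)).
    move: (s%:C * _) => t; rewrite starB starZC mulrBl !mulrBr -!scalerAl -!scalerAr.
    by rewrite !(linearB f) !functionalZ -/w fzy !ge0_ReK.
  have := f_ge0 (z - (s%:C * w^*%C) *: y).
  rewrite E => /ge0_Re_ge0 H; apply: le_trans H _.
  rewrite cabsE sqr_sqrtr ?addr_ge0 ?sqr_ge0 //; case: (w) => u v /=.
  rewrite le_eqVlt; apply/orP; left; apply/eqP; ring.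
move: (cabs w) key => m key.
(* For [b = 0] the quadratic is affine in [s], and the [s] below would give it the value
   [a - (a + 1)]. *)
have [b_eq0|bN0] := eqVneq b 0.
  rewrite b_eq0 mulr0 leNgt; apply/negP => m0.
  have := key ((a + 1) / (2 * m ^+ 2)).
  rewrite b_eq0 mulr0 addr0.
  have -> : 2 * ((a + 1) / (2 * m ^+ 2)) * m ^+ 2 = a + 1.
    by field; apply: contraTneq m0 => ->; rewrite expr0n ltxx.
  lra.
have bp : 0 < b by rewrite lt_def bN0.
(* [b^-1] minimizes the quadratic. *)
have h := key b^-1; rewrite -subr_ge0.
have E : a - 2 * b^-1 * m ^+ 2 + b^-1 ^+ 2 * m ^+ 2 * b
  = (a * b - m ^+ 2) / b by field.
by rewrite E pmulr_lge0 ?invr_gt0 in h.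
Qed.

Lemma Re_positive_functional_ge0 y : 0 <= complex.Re (f (star y * y)).
Proof. exact: ge0_Re_ge0. Qed.

Lemma cabs_functional_le_sqrt y z :
  cabs (f (star z * y)) <=
  Num.sqrt (complex.Re (f (star z * z)) * complex.Re (f (star y * y))).
Proof.
rewrite -[leLHS]ger0_norm ?cabs_ge0 // -sqrtr_sqr ler_wsqrtr //.
exact: positive_functional_CS.
Qed.

(* Reflecting [p] in the unit vector [e] preserves the seminorm of [f], and
   <p,e><e,q> - <p,q>/2 = <2<p,e>e - p, q>/2. *)
Lemma buzano e p q : f (star e * e) = 1 ->
  cabs (f (star q * e) * f (star e * p)) <=
  (cabs (f (star q * p)) + Num.sqrt (complex.Re (f (star q * q))
                                     * complex.Re (f (star p * p)))) / 2.
Proof.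
move=> fe; set w := f (star e * p); set r := (2 * w) *: e - p.
have fpe : f (star p * e) = w^*%C.
  by rewrite -positive_functional_star starM starK.
have frr : f (star r * r) = f (star p * p).
  rewrite /r; have [t tE] : {t | 2 * w = t} by exists (2 * w).
  rewrite tE starB starZC mulrBl !mulrBr -!scalerAl -!scalerAr.
  rewrite !(linearB f) !functionalZ -/w fpe fe -tE rmorphM rmorph_nat; ring.
have fqr : f (star q * r) = 2 * w * f (star q * e) - f (star q * p).
  by rewrite mulrBr -scalerAr (linearB f) functionalZ.
have := cabs_functional_le_sqrt r q; rewrite frr fqr => h.
have -> : f (star q * e) * w
  = (2^-1)%:C * ((2 * w * f (star q * e) - f (star q * p)) + f (star q * p)).
  by rewrite fmorphV rmorph_nat; field.
rewrite cabsM cabsr ger0_norm ?invr_ge0 // mulrC ler_pM2r ?invr_gt0 //.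
by apply: le_trans (cabsD _ _) _; rewrite addrC lerD2l.
Qed.

(** The condition on [q] turns the product in Buzano's inequality into a square. The geometric mean
    is at most [(Q + P) / 2], so the weight [alpha] gives [alpha / 4] to both [P] and [Q];
    Cauchy-Schwarz adds [1 - alpha] to [P]. *)
Lemma sqr_functional_le (alpha : R) e p q : 0 <= alpha <= 1 ->
  f (star e * e) = 1 -> f (star q * e) = f (star e * p) ->
  cabs (f (star e * p)) ^+ 2 <= alpha / 2 * cabs (f (star q * p))
    + (alpha / 4 * complex.Re (f (star q * q))
       + (1 - 3 * alpha / 4) * complex.Re (f (star p * p))).
Proof.
move=> /andP[al0 al1] fe fqe.
have := buzano e p q fe; rewrite fqe cabsM -expr2.
have := positive_functional_CS p e; rewrite fe mul1r.
have p0 := Re_positive_functional_ge0 p.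
have q0 := Re_positive_functional_ge0 q.
move: (complex.Re (f (star p * p))) (complex.Re (f (star q * q))) p0 q0 => P Q p0 q0.
have : Num.sqrt (Q * P) <= (Q + P) / 2.
  rewrite -[leRHS]ger0_norm ?divr_ge0 ?addr_ge0 // -sqrtr_sqr ler_wsqrtr //.
  by rewrite -subr_ge0 (_ : _ - _ = ((Q - P) / 2) ^+ 2) ?sqr_ge0 //; field.
move: (cabs _) (cabs _) (Num.sqrt _) => n m s h1 h2 h3.
have h4 : m ^+ 2 <= n / 2 + (Q + P) / 4 by lra.
have : alpha * m ^+ 2 <= alpha * (n / 2 + (Q + P) / 4) by rewrite ler_wpM2l.
have : (1 - alpha) * m ^+ 2 <= (1 - alpha) * P by rewrite ler_wpM2l ?subr_ge0.
lra.
Qed.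

End PositiveFunctional.

(** * The inequality for the [a]-numerical radius *)

Section ANumericalRadius.
Context {R : realType} {A : cstarAlgType R}.
Implicit Types (a x y : A) (f : {linear A -> R[i]^o}).

Lemma positive_star a : positive a -> star a = a.
Proof. by case=> c ->; rewrite starM starK. Qed.

(** Membership of [0] makes the supremum nonnegative, so that its bound [Num.sqrt m] can be
    squared. *)
Lemma ereal_sup_sqr_le (S : set (\bar R)) (M : \bar R) : (0 <= M)%E -> S 0%E ->
  (forall s, S s -> exists2 r : R, s = r%:E & (0 <= r) /\ ((r ^+ 2)%:E <= M)%E) ->
  (ereal_sup S ^+ 2 <= M)%E.
Proof.
case: M => [m| |] //; last by move=> *; rewrite leey.
rewrite lee_fin => m0 S0 hS; have sup_ge0 : (0 <= ereal_sup S)%E.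
  exact: ereal_sup_ubound.
have sup_le : (ereal_sup S <= (Num.sqrt m)%:E)%E.
  apply: ge_ereal_sup => s /hS[r -> [r0]]; rewrite !lee_fin => rm.
  by rewrite -[leLHS]ger0_norm // -sqrtr_sqr ler_wsqrtr.
rewrite expe2; apply: le_trans (lee_pmul _ _ sup_le sup_le) _ => //.
by rewrite -EFinM -expr2 sqr_sqrtr.
Qed.

Lemma cabs_a_state_le_norm a f x : positive a -> a_states a f ->
  ((cabs (f (a * x)))%:E <= a_norm a x)%E.
Proof.
move=> [c ac] fS; have [[_ f0] fa] := fS.
apply: (@le_trans _ _ (Num.sqrt (complex.Re (f (star x * a * x))))%:E); last first.
  by apply: ereal_sup_ubound; right; exists f.
have := cabs_functional_le_sqrt f f0 (c * x) c.
by rewrite -ac fa mul1r lee_fin starM ac !mulrA.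
Qed.

Lemma a_num_radius_ubound a f x : a_states a f ->
  ((cabs (f (a * x)))%:E <= a_num_radius a x)%E.
Proof. by move=> fa; apply: ereal_sup_ubound; right; exists f. Qed.

Lemma a_num_radius_ge0 a x : (0 <= a_num_radius a x)%E.
Proof. by apply: ereal_sup_ubound; left. Qed.

Lemma a_norm_ge0 a x : (0 <= a_norm a x)%E.
Proof. by apply: ereal_sup_ubound; left. Qed.

Lemma a_num_radius_sqr_le a (k : R) x w : 0 <= k ->
  (forall f, a_states a f -> cabs (f (a * x)) ^+ 2
     <= k * cabs (f (a * x ^+ 2)) + cabs (f (a * w))) ->
  positive a ->
  (a_num_radius a x ^+ 2 <= k%:E * a_num_radius a (x ^+ 2)%R + a_norm a w)%E.
Proof.
move=> k0 hf a0; apply: ereal_sup_sqr_le.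
- by rewrite adde_ge0 ?mule_ge0 ?a_num_radius_ge0 ?a_norm_ge0 ?lee_fin.
- by left.
move=> s [->|[f fa <-]].
  exists 0 => //; split=> //; rewrite expr0n.
  by rewrite adde_ge0 ?mule_ge0 ?a_num_radius_ge0 ?a_norm_ge0 ?lee_fin.
exists (cabs (f (a * x))) => //; split; first exact: cabs_ge0.
apply: (@le_trans _ _ (k * cabs (f (a * x ^+ 2)) + cabs (f (a * w)))%:E).
  by rewrite lee_fin hf.
rewrite EFinD EFinM leeD ?cabs_a_state_le_norm //.
by rewrite lee_wpmul2l ?lee_fin ?a_num_radius_ubound.
Qed.

Lemma Re_functional_le f (s t : R) u v :
  s * complex.Re (f u) + t * complex.Re (f v) <= cabs (f (s%:C *: u + t%:C *: v)).
Proof.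
by rewrite -!ReZ -ReD -!functionalZ -(linearD f) Re_le_cabs.
Qed.

(** With [a = star c * c], the bound for one state is applied to [e = c] and the vectors [c * x] and
    [c * xs], in either order. *)
Lemma a_num_radius_buzano a (alpha : R) x xs : positive a ->
  0 <= alpha <= 1 -> a_adjoint a x xs ->
  (a_num_radius a x ^+ 2
    <= (alpha / 2)%:E * a_num_radius a (x ^+ 2)%R
       + a_norm a ((alpha / 4)%:C *: (x * xs)
                   + (1 - 3 * alpha / 4)%:C *: (xs * x))%R)%E /\
  (a_num_radius a x ^+ 2
    <= (alpha / 2)%:E * a_num_radius a (x ^+ 2)%R
       + a_norm a ((alpha / 4)%:C *: (xs * x)
                   + (1 - 3 * alpha / 4)%:C *: (x * xs))%R)%E.
Proof.
move=> a0 al; rewrite /a_adjoint => axs.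
have sa := positive_star _ a0; have [c ac] := a0.
(* The relation is symmetric: [x] is an [a]-adjoint of [xs]. *)
have sxs : star xs * a = a * x.
  by rewrite -[LHS]starK starM starK sa axs starM starK sa.
have al2 : 0 <= alpha / 2 by case/andP: al => ? _; rewrite divr_ge0.
have ip u v : star (c * u) * (c * v) = star u * a * v by rewrite ac starM !mulrA.
have c_l u : star c * (c * u) = a * u by rewrite ac mulrA.
have c_r u : star (c * u) * c = star u * a by rewrite ac starM mulrA.
have xx : star x * a * x = a * (xs * x) by rewrite -axs mulrA.
have yy : star xs * a * xs = a * (x * xs) by rewrite sxs mulrA.
have fin f u v : f (a * ((alpha / 4)%:C *: u + (1 - 3 * alpha / 4)%:C *: v))
    = f ((alpha / 4)%:C *: (a * u) + (1 - 3 * alpha / 4)%:C *: (a * v)).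
  by rewrite mulrDr -!scalerAr.
split; apply: a_num_radius_sqr_le => // f [[_ f0] fa]; rewrite fin.
- have := sqr_functional_le f f0 alpha c (c * x) (c * xs) al.
  rewrite !ip c_l c_r -ac => /(_ fa); rewrite xx yy sxs => /(_ erefl) h.
  apply: le_trans h _; rewrite -(mulrA a) -expr2.
  by rewrite lerD2l Re_functional_le.
- have := sqr_functional_le f f0 alpha c (c * xs) (c * x) al.
  rewrite !ip c_l c_r -ac => /(_ fa); rewrite axs xx yy => /(_ erefl).
  (* After the exchange of the vectors, [f] takes the conjugates of the wanted values, which have
     the same modulus. *)
  have -> : star x * a * xs = star (a * x ^+ 2).
    by rewrite -mulrA axs expr2 !starM sa !mulrA.
  have -> : star x * a = star (a * x) by rewrite starM sa.
  rewrite !positive_functional_star // !cabs_conj => h.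
  by apply: le_trans h _; rewrite lerD2l Re_functional_le.
Qed.

End ANumericalRadius.

(** * Elementary properties of the norm *)

Section CNorm.
Context {R : realType} {A : cstarAlgType R}.
Implicit Types (x y z : A).

Lemma cnorm0 : cnorm (0 : A) = 0.
Proof. by rewrite -[0 : A](scale0r 0) cnormZ cabs0 mul0r. Qed.

Lemma cnormZr (t : R) x : cnorm (t%:C *: x) = `|t| * cnorm x.
Proof. by rewrite cnormZ cabsr. Qed.

Lemma cnormN x : cnorm (- x) = cnorm x.
Proof. by rewrite -scaleN1r cnormZ cabsN -[1]/(1%:C) cabsr normr1 mul1r. Qed.

Lemma cnorm_ge0 x : 0 <= cnorm x.
Proof. by have := cnormD x (- x); rewrite subrr cnorm0 cnormN; lra. Qed.

Lemma cnormB x y : cnorm (x - y) <= cnorm x + cnorm y.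
Proof. by rewrite -[cnorm y]cnormN cnormD. Qed.

Lemma cnorm_dist x y : cnorm (x - y) = cnorm (y - x).
Proof. by rewrite -cnormN opprB. Qed.

Lemma cnorm_triangle y x z : cnorm (x - z) <= cnorm (x - y) + cnorm (y - z).
Proof. by apply: le_trans (cnormD _ _); rewrite addrA subrK. Qed.

Lemma cnorm_starE x : cnorm (star x) = cnorm x.
Proof.
have le_star (u : A) : cnorm u <= cnorm (star u).
  have := cnormM (star u) u; rewrite cnorm_star expr2.
  have [->|uN0] := eqVneq (cnorm u) 0.
    by move=> _; exact: cnorm_ge0.
  by rewrite ler_pM2r // lt_def uN0 cnorm_ge0.
by apply/le_anti; rewrite le_star -{2}[x]starK le_star.
Qed.

Lemma cnorm1 : cnorm (1 : A) = 1.
Proof.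
have := cnorm_star (1 : A); rewrite star1 mulr1 expr2 => n1.
have /mulIf : cnorm (1 : A) != 0.
  by apply/eqP => /cnorm0_eq0/eqP; rewrite oner_eq0.
by apply; rewrite mul1r -n1.
Qed.

Lemma cnormX x n : cnorm (x ^+ n) <= cnorm x ^+ n.
Proof.
elim: n => [|n IH]; first by rewrite !expr0 cnorm1.
rewrite !exprS; apply: le_trans (cnormM _ _) _.
by rewrite ler_wpM2l ?cnorm_ge0.
Qed.

Lemma cnorm_sqr_sa x : star x = x -> cnorm (x ^+ 2) = cnorm x ^+ 2.
Proof. by move=> sx; rewrite -cnorm_star sx expr2. Qed.

End CNorm.

(** Bernoulli's inequality and the Archimedean property. *)
Lemma expr_unbounded {R : realType} (q M : R) : 1 < q -> exists n, M < q ^+ n.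
Proof.
move=> q1; have bern n : 1 + n%:R * (q - 1) <= q ^+ n.
  elim: n => [|n IH]; first by rewrite mul0r addr0.
  have : q * (1 + n%:R * (q - 1)) <= q ^+ n.+1 by rewrite exprS ler_wpM2l ?IH //; lra.
  rewrite -natr1 => h; apply: le_trans h.
  rewrite -subr_ge0 (_ : _ - _ = n%:R * (q - 1) ^+ 2); last by ring.
  by rewrite mulr_ge0 ?sqr_ge0.
have d0 : 0 < q - 1 by lra.
exists (Num.bound `|M / (q - 1)|); apply: lt_le_trans (bern _).
have := archi_boundP (normr_ge0 (M / (q - 1))).
move/(le_lt_trans (ler_norm _)); rewrite ltr_pdivrMr // => h.
by rewrite (lt_le_trans h) // lerDr.
Qed.

(** * States are contractive *)

Section StateBound.
Context {R : realType} {A : cstarAlgType R} (f : {linear A -> R[i]^o}).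
Hypothesis fS : states f.
Implicit Types x y : A.

Let f_ge0 : forall x, 0 <= f (star x * x). Proof. by case: fS => -[]. Qed.
Let f1 : f 1 = 1. Proof. by case: fS. Qed.

Lemma state_sqr_le x : cabs (f x) ^+ 2 <= complex.Re (f (star x * x)).
Proof.
by have := positive_functional_CS f f_ge0 x 1; rewrite star1 !mul1r f1 mul1r.
Qed.

(* Iterating [f(h)^2 <= f(h^2)] gives [f(h)^(2^n) <= M * ||h||^(2^n)], where [M]
   bounds the functional. *)
Lemma state_sa_le_norm x : star x = x -> cabs (f x) <= cnorm x.
Proof.
move=> sx; have [[[M fM] _] _] := fS; rewrite leNgt; apply/negP => lt_xf.
have iter n : cabs (f x) ^+ (2 ^ n) <= M * cnorm x ^+ (2 ^ n).
  apply: (@le_trans _ _ (cabs (f (x ^+ (2 ^ n))))).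
    elim: n => [|n IH]; first by rewrite expn0 !expr1.
    rewrite expnSr !exprM; set u := x ^+ _ in IH *.
    have su : star u = u by rewrite starX sx.
    apply: (@le_trans _ _ (cabs (f u) ^+ 2)).
      by rewrite ler_pXn2r ?nnegrE ?exprn_ge0 ?cabs_ge0.
    apply: le_trans (state_sqr_le u) _.
    by rewrite su -expr2 Re_le_cabs.
  apply: le_trans (fM _) _.
  have [M0|M0] := leP 0 M; first by rewrite ler_wpM2l ?cnormX.
  have := fM 1; rewrite f1 -[1]/(1%:C) cabsr normr1 cnorm1; lra.
have [x0|xN0] := eqVneq (cnorm x) 0.
  by move: lt_xf; rewrite x0 (cnorm0_eq0 _ x0) (linear0 f) cabs0 ltxx.
have xp : 0 < cnorm x by rewrite lt_def xN0 cnorm_ge0.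
have q1 : 1 < cabs (f x) / cnorm x by rewrite ltr_pdivlMr ?mul1r.
have [n] := expr_unbounded _ M q1.
have q_le : (cabs (f x) / cnorm x) ^+ n <= (cabs (f x) / cnorm x) ^+ (2 ^ n).
  apply: ler_weXn2l; first exact: ltW.
  exact: ltnW (ltn_expl _ _).
move/lt_le_trans/(_ q_le); rewrite expr_div_n ltNge; apply/negP/negPn.
by rewrite ler_pdivrMr ?exprn_gt0.
Qed.

(** The norm identity for [star x * x] reduces this to the self-adjoint case. *)
Lemma state_le_norm x : cabs (f x) <= cnorm x.
Proof.
rewrite -ler_sqr ?nnegrE ?cabs_ge0 ?cnorm_ge0 // -cnorm_star.
apply: le_trans (state_sqr_le x) _; apply: le_trans (Re_le_cabs _) _.
by apply: state_sa_le_norm; rewrite starM starK.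
Qed.

End StateBound.

(** * The numerical radius as a real supremum *)

Section NumRadius.
Context {R : realType} {A : cstarAlgType R}.
Implicit Types (x : A) (f : {linear A -> R[i]^o}).

Lemma num_radius_ubound f x : states f -> cabs (f x) <= num_radius x.
Proof.
move=> fS; apply: sup_ubound; last by exists f.
by exists (cnorm x) => _ [g gS <-]; exact: state_le_norm.
Qed.

Lemma num_radius_ge0 x : 0 <= num_radius x.
Proof.
rewrite /num_radius; set S := [set _ | _ in _].
have [[s Ss]|S0] := pselect (S !=set0).
  have [f fS _] := Ss.
  by apply: le_trans (cabs_ge0 (f x)) _; exact: num_radius_ubound.
(* Without states the supremum is the default value [0]. *)
by rewrite sup_out // => -[].
Qed.

(** A positive [sup] is not the default value [0], so the supremum is a genuine one. *)
Lemma num_radius_adherent x (e : R) : 0 < num_radius x -> 0 < e ->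
  exists2 f, states f & num_radius x - e < cabs (f x).
Proof.
rewrite /num_radius; set S := [set _ | _ in _] => S0 e0.
have supS : has_sup S.
  by apply: contrapT => /sup_out; move: S0 => /[swap] ->; rewrite ltxx.
by have [_ [f fS <-] ?] := sup_adherent e0 supS; exists f.
Qed.

End NumRadius.

(** * Continuity on the spectrum by epsilon and delta *)

Section Continuity.
Context {R : realType}.

Lemma within_continuous_dist (D : set R) (phi : R -> R) (x e : R) :
  {within D, continuous phi} -> D x -> 0 < e ->
  exists2 d, 0 < d & forall y, D y -> `|y - x| < d -> `|phi y - phi x| < e.
Proof.
move=> /subspace_continuousP/(_ x) cphi /cphi/cvgrPdist_lt/[apply].
rewrite near_withinE => /nbhs_ballP[d d0 H]; exists d => // y Dy yx.
by rewrite distrC; apply: H => //; rewrite -ball_normE /= distrC.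
Qed.

Context {A : cstarAlgType R}.
Implicit Types (y : A) (g : R[i] -> R[i]).

Lemma continuous_on_spectrum_dist y g z (e : R) :
  continuous_on_spectrum y g -> spectrum y z -> 0 < e ->
  exists2 d : R, 0 < d & forall w, spectrum y w -> cabs (w - z) < d ->
    cabs (g w - g z) < e.
Proof.
move=> /subspace_continuousP/(_ z) cg /cg/cvgrPdist_lt/(_ e%:C) + e0.
rewrite ltcR => /(_ e0); rewrite near_withinE => /nbhs_ballP[d /= d0 H].
have dE : (complex.Re d)%:C = d by apply: ge0_ReK; exact: ltW.
exists (complex.Re d) => [|w Dw wz]; first by rewrite -ltcR dE.
rewrite -ltcR cabsC -normrN opprB; apply: H => //.
by rewrite -ball_normE /= -normrN opprB -cabsC -dE ltcR.
Qed.

Lemma continuous_on_spectrumP y g :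
  (forall z (e : R), 0 < e -> exists2 d : R, 0 < d & forall w,
    cabs (w - z) < d -> cabs (g w - g z) < e) -> continuous_on_spectrum y g.
Proof.
move=> H; apply: (@continuous_subspaceT R[i]^o R[i]^o) => z.
apply/(@cvgrPdist_lt _ R[i]^o _ _ (nbhs_filter (z : R[i]^o))) => e e0.
have eE : (complex.Re e)%:C = e by apply: ge0_ReK; exact: ltW.
have [|d d0 Hd] := H z (complex.Re e); first by rewrite -ltcR eE.
apply/nbhs_ballP; exists d%:C; first by rewrite /= ltcR.
move=> w; rewrite -ball_normE /= => zw.
rewrite -eE -normrN opprB -cabsC ltcR; apply: Hd.
by rewrite -ltcR cabsC -normrN opprB.
Qed.

Lemma continuous_on_spectrum_cst y (c : R[i]) :
  continuous_on_spectrum y (fun=> c).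
Proof.
apply: continuous_on_spectrumP => z e e0; exists 1 => // w _.
by rewrite subrr cabs0.
Qed.

Lemma continuous_on_spectrum_id y : continuous_on_spectrum y id.
Proof. by apply: continuous_on_spectrumP => z e e0; exists e. Qed.

Lemma continuous_on_spectrum_conj y :
  continuous_on_spectrum y (fun z => z^*%C).
Proof.
apply: continuous_on_spectrumP => z e e0; exists e => // w.
by rewrite -rmorphB cabs_conj.
Qed.

Lemma continuous_on_spectrum_Re y (k : R -> R) : continuous k ->
  continuous_on_spectrum y (fun z => (k (complex.Re z))%:C).
Proof.
move=> ck; apply: continuous_on_spectrumP => z e e0.
have /cvgrPdist_lt/(_ e e0)/nbhs_ballP[d d0 H] := ck (complex.Re z).
exists d => // w wz; rewrite -rmorphB cabsr distrC; apply: H.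
rewrite -ball_normE /= distrC; apply: le_lt_trans wz.
by have := cabs_geRe (w - z); case: (w) => ? ?; case: (z).
Qed.

End Continuity.

(** * Supporting lines of convex functions *)

Definition convex_fun {R : realType} (psi : R -> R) := forall x y l : R,
  0 <= l <= 1 -> psi (l * x + (1 - l) * y) <= l * psi x + (1 - l) * psi y.

(** The slope [c] is the supremum of the slopes of the chords to the left of [t0]; no chord to the
    right has a smaller slope. *)
Lemma convex_subgradient {R : realType} (psi : R -> R) (t0 : R) :
  convex_fun psi -> exists c, forall t, psi t0 + c * (t - t0) <= psi t.
Proof.
move=> cpsi.
pose S := [set (psi t0 - psi s) / (t0 - s) | s in [set s | s < t0]].
have slope s t : s < t0 -> t0 < t ->
    (psi t0 - psi s) / (t0 - s) <= (psi t - psi t0) / (t - t0).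
  (* This weight writes [t0] as [l * s + (1 - l) * t]. *)
  move=> st0 t0t; pose l := (t - t0) / (t - s).
  have ts : 0 < t - s by lra.
  have lE : 1 - l = (t0 - s) / (t - s) by rewrite /l; field; lra.
  have := cpsi s t l; rewrite lE.
  have -> : l * s + (t0 - s) / (t - s) * t = t0 by rewrite /l; field; lra.
  have -> : 0 <= l <= 1.
    by rewrite /l divr_ge0 ?ler_pdivrMr ?mul1r //=; lra.
  move=> /(_ isT); rewrite /l mulrAC -[X in _ + X]mulrAC -mulrDl.
  rewrite ler_pdivlMr // => h.
  by rewrite ler_pdivrMr ?subr_gt0 // mulrAC ler_pdivlMr ?subr_gt0 //; nra.
have ubS : has_ubound S.
  exists ((psi (t0 + 1) - psi t0) / (t0 + 1 - t0)) => _ [s /= st0 <-].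
  by apply: slope => //; lra.
exists (sup S) => t; have [tt0|t0t|->] := ltgtP t t0; last by lra.
- have : (psi t0 - psi t) / (t0 - t) <= sup S by apply: sup_ubound => //; exists t.
  by rewrite ler_pdivrMr ?subr_gt0 //; lra.
- have : sup S <= (psi t - psi t0) / (t - t0).
    apply: ge_sup => [|_ [s /= st0 <-]]; last exact: slope.
    by exists ((psi t0 - psi (t0 - 1)) / (t0 - (t0 - 1))), (t0 - 1) => //=; lra.
  by rewrite ler_pdivlMr ?subr_gt0 //; lra.
Qed.

(** * Orlicz functions extended to the whole line *)

Section Orlicz.
Context {R : realType} (phi : R -> R).
Hypothesis phi_orlicz : orlicz phi.

(** The extension is convex on all of [R], so it has a supporting line at every point, [0]
    included. *)
Let psi t := phi (Num.max 0 t).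

(** [Num.max 0] is convex, and [phi] is nondecreasing and convex. *)
Lemma orlicz_max0_convex : convex_fun psi.
Proof.
move=> x y l /andP[l0 l1]; rewrite /psi.
set u := Num.max 0 x; set v := Num.max 0 y.
have u0 : 0 <= u by rewrite le_max lexx.
have v0 : 0 <= v by rewrite le_max lexx.
apply: (@le_trans _ _ (phi (l * u + (1 - l) * v))).
  apply: (orlicz_homo phi_orlicz); first by rewrite le_max lexx.
  rewrite ge_max addr_ge0 ?mulr_ge0 ?subr_ge0 //=.
  by rewrite lerD ?ler_wpM2l ?subr_ge0 // le_max lexx orbT.
have [t tE] : exists t : {i01 R}, t%:num = l.
  by exists (Itv01 l0 l1).
have := @orlicz_convex _ _ phi_orlicz t u v; rewrite !inE /= !in_itv /= !andbT.
by move=> /(_ u0 v0); rewrite -tE.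
Qed.

Lemma orlicz_max0_continuous : continuous psi.
Proof.
move=> x; apply/cvgrPdist_lt => e e0.
have max0 t : 0 <= Num.max 0 t :> R by rewrite le_max lexx.
have [||d d0 H] :=
    within_continuous_dist _ _ (Num.max 0 x) e (orlicz_continuous phi_orlicz).
- by rewrite /= in_itv /= max0.
- by [].
apply/nbhs_ballP; exists d => // y yx; have {}yx : `|y - x| < d by rewrite distrC.
rewrite distrC; apply: H; first by rewrite /= in_itv /= max0.
apply: le_lt_trans yx.
have := ler_norm (y - x); have := ler_norm (x - y); rewrite distrC.
move: `|y - x| => m h1 h2; rewrite ler_norml.
by case: (leP 0 x) => x0; case: (leP 0 y) => y0; apply/andP; split; lra.
Qed.

End Orlicz.

Lemma state_jensen {R : realType} {A : cstarAlgType R} (y : A) Phi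
  (f : {linear A -> R[i]^o}) (psi : R -> R) :
  functional_calculus y Phi -> star y = y -> states f ->
  convex_fun psi -> continuous psi ->
  psi (complex.Re (f y)) <= complex.Re (f (Phi (fun z => (psi (complex.Re z))%:C))).
Proof.
move=> HPhi sy [[_ f0] f1] psi_cvx psi_cts; set t0 := complex.Re (f y).
have [c hc] := convex_subgradient psi t0 psi_cvx.
pose k t := Num.sqrt (psi t - (psi t0 + c * (t - t0))).
have cM (d : R) : continuous (fun t : R => d * t).
  by move=> t; apply: continuousM => //; exact: cst_continuous.
have ck : continuous k.
  move=> t; apply: continuous_comp; last exact: sqrt_continuous.
  apply: continuousB; first exact: psi_cts.
  apply: continuousD; first exact: cst_continuous.
  apply: continuousM; first exact: cst_continuous.
  by apply: continuousB => //; exact: cst_continuous.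
pose s (z : R[i]) := (k (complex.Re z))%:C.
have cs : continuous_on_spectrum y s by exact: continuous_on_spectrum_Re.
have Phi_s : star (Phi s) = Phi s.
  rewrite -(fcalc_star HPhi) //; congr Phi; apply/funext => z.
  exact: conjc_real.
(* The real part is half of [z + z^*], so its image is half of [y + star y]. *)
have Phi_Re : Phi (fun z => (complex.Re z)%:C) = y.
  have -> : (fun z : R[i] => (complex.Re z)%:C) = (fun z => (2^-1)%:C * (z + z^*%C)).
    apply/funext => -[u v]; apply/eqP; rewrite eq_complex /=.
    by apply/andP; split; apply/eqP; field.
  rewrite (fcalcZ HPhi); last first.
    rewrite (_ : (fun z : R[i] => z + z^*%C) = fun z => (2 * complex.Re z)%:C).
      exact: (continuous_on_spectrum_Re y (fun t => 2 * t)).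
    apply/funext => -[u v]; apply/eqP; rewrite eq_complex /=.
    by apply/andP; split; apply/eqP; ring.
  have cid := continuous_on_spectrum_id y.
  rewrite (fcalcD HPhi) //; last exact: continuous_on_spectrum_conj.
  rewrite (fcalc_star HPhi (g := id)) // (fcalc_id HPhi) sy.
  rewrite -[y]scale1r -scalerDl scalerA; congr (_ *: _).
  by apply/eqP; rewrite eq_complex /=; apply/andP; split; apply/eqP; field.
have cRe : continuous_on_spectrum y (fun z => (complex.Re z)%:C).
  by apply: (continuous_on_spectrum_Re y id) => t; exact: cvg_id.
(* Supporting line plus [s * s]: on the image of the line [f] has real part [psi t0], and on that of
   [s * s] it is nonnegative. *)
have -> : Phi (fun z => (psi (complex.Re z))%:C)
    = (psi t0 - c * t0)%:C *: 1 + c%:C *: y + star (Phi s) * Phi s.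
  have -> : (fun z : R[i] => (psi (complex.Re z))%:C)
    = (fun z => ((psi t0 - c * t0)%:C * 1 + c%:C * (complex.Re z)%:C) + s z * s z).
    apply/funext => z; rewrite /s -!rmorphM -!rmorphD /=; congr (_%:C).
    rewrite -expr2 sqr_sqrtr ?subr_ge0 //; ring.
  have lin_E : (fun z : R[i] => (psi t0 - c * t0)%:C * 1 + c%:C * (complex.Re z)%:C)
    = fun z => ((psi t0 - c * t0) + c * complex.Re z)%:C.
    by apply/funext => z; rewrite mulr1 -rmorphM -rmorphD.
  rewrite (fcalcD HPhi); last 2 first.
  - rewrite lin_E.
    apply: (continuous_on_spectrum_Re y (fun t => psi t0 - c * t0 + c * t)).
    by move=> t; apply: cvgD; [exact: cvg_cst|exact: cM].
  - rewrite (_ : (fun z => s z * s z)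
                  = fun z => (k (complex.Re z) * k (complex.Re z))%:C).
      apply: (continuous_on_spectrum_Re y (fun t => k t * k t)) => t.
      by apply: continuousM; exact: ck.
    by apply/funext => z; rewrite -rmorphM.
  rewrite (fcalcM HPhi) // Phi_s; congr (_ + _).
  rewrite (fcalcD HPhi); last 2 first.
  - exact: continuous_on_spectrum_cst.
  - rewrite (_ : (fun z : R[i] => c%:C * _) = fun z => (c * complex.Re z)%:C).
      exact: (continuous_on_spectrum_Re y (fun t => c * t)).
    by apply/funext => z; rewrite -rmorphM.
  rewrite !(fcalcZ HPhi) //; last exact: continuous_on_spectrum_cst.
  by rewrite (fcalc1 HPhi) Phi_Re.
rewrite !(linearD f) !functionalZ f1 !ReD !ReZ -/t0 /=.
by have := ge0_Re_ge0 _ (f0 (Phi s)); lra.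
Qed.

(** * Closed predicates and Banach's fixed point theorem *)

Section ClosedPredicates.
Context {R : realType} {A : cstarAlgType R}.
Implicit Types (x y z l h : A) (D E : A -> Prop).

Definition norm_closed D :=
  forall l, (forall e : R, 0 < e -> exists2 x, D x & cnorm (x - l) <= e) -> D l.

Lemma norm_closedI D E : norm_closed D -> norm_closed E ->
  norm_closed (fun x => D x /\ E x).
Proof.
move=> cD cE l hl; split; [apply: cD|apply: cE] => e e0;
  by have [x [Dx Ex] xl] := hl e e0; exists x.
Qed.

Lemma eq0_of_norm_le (c : R) x : (forall e : R, 0 < e -> cnorm x <= c * e) -> x = 0.
Proof.
move=> h; apply: cnorm0_eq0; apply/le_anti; rewrite cnorm_ge0 andbT.
rewrite leNgt; apply/negP => x0.
have c0 : 0 < `|c| + 1 by rewrite ltr_wpDl.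
have := h (cnorm x / (2 * (`|c| + 1))) (divr_gt0 x0 (mulr_gt0 (ltr0n _ 2) c0)).
have : c * (cnorm x / (2 * (`|c| + 1))) <= (`|c| + 1) * (cnorm x / (2 * (`|c| + 1))).
  rewrite ler_wpM2r ?divr_ge0 ?mulr_ge0 ?cnorm_ge0 ?(ltW c0) //.
  by rewrite ler_wpDr ?ler_norm.
have -> : (`|c| + 1) * (cnorm x / (2 * (`|c| + 1))) = cnorm x / 2.
  by field; rewrite gt_eqF.
lra.
Qed.

Lemma norm_closed_star : norm_closed (fun x => star x = x).
Proof.
move=> l hl; apply/eqP; rewrite -subr_eq0; apply/eqP.
apply: (eq0_of_norm_le 2) => e e0; have [x sx xl] := hl e e0.
apply: le_trans (cnorm_triangle x _ _) _.
rewrite -{1}sx -starB cnorm_starE cnorm_dist; lra.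
Qed.

Lemma norm_closed_ball (r : R) : norm_closed (fun x => cnorm x <= r).
Proof.
move=> l hl; apply/ler_addgt0Pr => e e0; have [x xr xl] := hl e e0.
rewrite -[l](subrK x) addrC; apply: le_trans (cnormD _ _) _.
by rewrite lerD // cnorm_dist.
Qed.

Lemma norm_closed_commute z : norm_closed (fun x => z * x = x * z).
Proof.
move=> l hl; apply/eqP; rewrite -subr_eq0; apply/eqP.
apply: (eq0_of_norm_le (2 * cnorm z)) => e e0; have [x zx xl] := hl e e0.
have -> : z * l - l * z = (x - l) * z - z * (x - l).
  by rewrite mulrBr mulrBl zx opprB [RHS]addrC addrA subrK.
apply: le_trans (cnormB _ _) _.
have := cnormM (x - l) z; have := cnormM z (x - l).
have : cnorm z * cnorm (x - l) <= cnorm z * e by rewrite ler_wpM2l ?cnorm_ge0.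
lra.
Qed.

(** The predicate is the bicommutant of [h], in which the square roots below are found. *)
Lemma norm_closed_commutant h :
  norm_closed (fun x => forall z, z * h = h * z -> z * x = x * z).
Proof.
move=> l hl z zh; apply: norm_closed_commute => e e0.
by have [x hx xl] := hl e e0; exists x => //; exact: hx.
Qed.

(** Banach's theorem: consecutive iterates differ by at most [C * k ^+ n], so they form a Cauchy
    sequence, whose limit lies in the closed [D]. *)
Lemma contraction_fixpoint D (F : A -> A) (k : R) x0 : norm_closed D ->
  0 <= k < 1 -> D x0 -> (forall x, D x -> D (F x)) ->
  (forall x y, D x -> D y -> cnorm (F x - F y) <= k * cnorm (x - y)) ->
  exists2 l, D l & F l = l.
Proof.
move=> cD /andP[k0 k1] Dx0 DF kF; pose u n := iter n F x0.
have Du n : D (u n) by elim: n => //= n; exact: DF.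
pose C := cnorm (u 1 - u 0).
have C0 : 0 <= C by exact: cnorm_ge0.
have step n : cnorm (u n.+1 - u n) <= C * k ^+ n.
  elim: n => [|n IH]; first by rewrite mulr1.
  apply: le_trans (kF _ _ (Du n.+1) (Du n)) _.
  by rewrite exprS mulrCA ler_wpM2l.
have tail n m : cnorm (u (n + m)%N - u n) <= C * k ^+ n / (1 - k).
  suff : (1 - k) * cnorm (u (n + m)%N - u n) <= C * k ^+ n * (1 - k ^+ m).
    have km : 0 <= k ^+ m by rewrite exprn_ge0.
    have Ckn : 0 <= C * k ^+ n by rewrite mulr_ge0 ?exprn_ge0.
    rewrite ler_pdivlMr ?subr_gt0 // => h; rewrite mulrC; apply: le_trans h _.
    by rewrite -[leRHS]mulr1 ler_wpM2l //; lra.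
  elim: m => [|m IH]; first by rewrite addn0 subrr cnorm0 expr0 subrr !mulr0.
  rewrite addnS; have := cnorm_triangle (u (n + m)%N) (u (n + m).+1) (u n).
  have := step (n + m)%N; rewrite exprD exprS => h1 h2.
  have : (1 - k) * cnorm (u (n + m).+1 - u n)
     <= (1 - k) * (C * (k ^+ n * k ^+ m) + cnorm (u (n + m)%N - u n)).
    by rewrite ler_wpM2l ?subr_ge0 ?(ltW k1) // (le_trans h2) // lerD2r.
  move=> h; apply: le_trans h _; rewrite mulrDr.
  have -> : C * k ^+ n * (1 - k * k ^+ m)
    = (1 - k) * (C * (k ^+ n * k ^+ m)) + C * k ^+ n * (1 - k ^+ m) by ring.
  by rewrite lerD2l.
have small e : 0 < e -> exists N, forall n, (N <= n)%N -> C * k ^+ n / (1 - k) < e.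
  (* [k = 0] has no inverse; its powers vanish from exponent [1] on. *)
  move=> e0; have [->|kN0] := eqVneq k 0.
    by exists 1%N => -[|n] // _; rewrite expr0n mulr0 mul0r.
  have kp : 0 < k by rewrite lt_def kN0.
  have [|N hN] := expr_unbounded k^-1 (C / (1 - k) / e); first by rewrite invf_gt1.
  exists N => n Nn; rewrite mulrAC.
  move: hN; rewrite ltr_pdivrMr // exprVn ltr_pdivlMl ?exprn_gt0 // => hN.
  apply: le_lt_trans hN; rewrite [leRHS]mulrC ler_wpM2l ?divr_ge0 ?subr_ge0 ?(ltW k1) //.
  by rewrite ler_wiXn2l // ltW.
have [|l hl] := cnorm_complete u.
  move=> e e0; have [N hN] := small (e / 2) (divr_gt0 e0 (ltr0n _ 2)).
  exists N => m n Nm Nn.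
  apply: le_lt_trans (cnorm_triangle (u N) _ _) _.
  have := tail N (m - N)%N; have := tail N (n - N)%N; rewrite !subnKC // cnorm_dist.
  by have := hN N (leqnn N); lra.
have Dl : D l.
  apply: cD => e e0; have [N hN] := hl e e0.
  by exists (u N) => //; rewrite ltW ?hN.
exists l => //; apply/eqP; rewrite -subr_eq0; apply/eqP.
apply: (eq0_of_norm_le 2) => e e0; have [N hN] := hl e e0.
apply: le_trans (cnorm_triangle (u N.+1) _ _) _.
have h1 := hN N.+1 (leqnSn N); have := kF _ _ (Du N) Dl.
have := hN N (leqnn N); rewrite (cnorm_dist (F l)) => h2 h3.
have : k * cnorm (u N - l) <= 1 * cnorm (u N - l).
  by rewrite ler_wpM2r ?cnorm_ge0 ?(ltW k1).
rewrite -[F (u N)]/(u N.+1) in h3; lra.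
Qed.

End ClosedPredicates.

(** * Invertibility, Neumann series and square roots *)

Section Invertible.
Context {R : realType} {A : cstarAlgType R}.
Implicit Types (x y z h : A).

Lemma invertible1 : invertible (1 : A).
Proof. by exists 1; rewrite mulr1. Qed.

Lemma not_invertible0 : ~ invertible (0 : A).
Proof. by case=> y [+ _]; rewrite mul0r => /esym/eqP; rewrite oner_eq0. Qed.

Lemma invertibleM x y : invertible x -> invertible y -> invertible (x * y).
Proof.
move=> [u [xu ux]] [v [yv vy]]; exists (v * u); split.
  by rewrite mulrA -(mulrA x) yv mulr1.
by rewrite mulrA -(mulrA v) ux mulr1.
Qed.

Lemma invertibleZ (c : R[i]) x : c != 0 -> invertible x -> invertible (c *: x).
Proof.
move=> c0 [u [xu ux]]; exists (c^-1 *: u).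
by rewrite -!scalerAl -!scalerAr !scalerA xu ux mulVf // mulfV // !scale1r.
Qed.

Lemma invertibleN x : invertible x -> invertible (- x).
Proof. by case=> u [xu ux]; exists (- u); rewrite !mulrNN. Qed.

Lemma invertible_commute x u z :
  x * u = 1 -> u * x = 1 -> z * x = x * z -> z * u = u * z.
Proof.
move=> xu ux zx.
by rewrite -[z * u]mul1r -ux -mulrA (mulrA x) -zx -mulrA xu mulr1.
Qed.

Lemma invertible_mulVl x y : x * y = y * x -> invertible (x * y) -> invertible x.
Proof.
move=> xy [u [h1 h2]].
have ux : x * u = u * x.
  by apply: (invertible_commute (x * y)) => //; rewrite -[RHS]mulrA -xy.
by exists (y * u); rewrite mulrA h1 -mulrA -ux mulrA -xy h1.
Qed.

(** The inverse is the fixed point of [x |-> 1 + h * x]; restricting to elements that commute with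
    [h] makes it two-sided. *)
Lemma neumann h : cnorm h < 1 -> invertible (1 - h).
Proof.
move=> h1.
have [|||||l lh fix_l] :=
    contraction_fixpoint (fun x => h * x = x * h) (fun x => 1 + h * x) (cnorm h) 0.
- exact: norm_closed_commute.
- by rewrite cnorm_ge0.
- by rewrite mulr0 mul0r.
- by move=> x hx; rewrite mulrDr mulrDl mulr1 mul1r hx mulrA hx.
- by move=> x y _ _; rewrite opprD addrACA subrr add0r -mulrBr cnormM.
have hl : (1 - h) * l = 1 by rewrite mulrBl mul1r -{1}fix_l addrK.
by exists l; split => //; rewrite -[RHS]hl mulrBl mulrBr mulr1 mul1r lh.
Qed.

Lemma neumann_scale (c : R[i]) h : cnorm h < cabs c -> invertible (c *: 1 - h).
Proof.
move=> hc; have c0 : c != 0.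
  by apply: contraTneq hc => ->; rewrite cabs0 -leNgt cnorm_ge0.
have -> : c *: 1 - h = c *: (1 - c^-1 *: h).
  by rewrite scalerBr scalerA mulfV // scale1r.
apply: invertibleZ => //; apply: neumann; rewrite cnormZ.
have cp : 0 < cabs c by apply: le_lt_trans hc; exact: cnorm_ge0.
have -> : cabs c^-1 = (cabs c)^-1.
  apply: (mulfI (lt0r_neq0 cp)); rewrite -cabsM !mulfV ?(lt0r_neq0 cp) //.
  by rewrite -[1]/(1%:C) cabsr normr1.
by rewrite mulrC ltr_pdivrMr // mul1r.
Qed.

Lemma spectrum_le_norm y (z : R[i]) : spectrum y z -> cabs z <= cnorm y.
Proof. by move=> yz; rewrite leNgt; apply/negP => /neumann_scale. Qed.

(** If [l = (h + l * l) / 2], then [1 - l] squares to [1 - h]. On the ball of radius [cnorm h] the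
    map contracts by the factor [cnorm h], and it preserves self-adjointness and the bicommutant of
    [h]. *)
Lemma sqrt_exists h : star h = h -> cnorm h < 1 -> exists s,
  [/\ star s = s, s * s = 1 - h & forall z, z * h = h * z -> z * s = s * z].
Proof.
move=> sh h1; have h0 := cnorm_ge0 h.
pose D (x : A) := (star x = x /\ cnorm x <= cnorm h) /\
  forall z, z * h = h * z -> z * x = x * z.
pose F (x : A) := (2^-1 : R)%:C *: (h + x * x).
have nF x y : cnorm (x * x - y * y) <= (cnorm x + cnorm y) * cnorm (x - y).
  have -> : x * x - y * y = x * (x - y) + (x - y) * y.
    by rewrite mulrBr mulrBl addrA subrK.
  apply: le_trans (cnormD _ _) _.
  by have := cnormM x (x - y); have := cnormM (x - y) y; lra.
have half0 : `|2^-1 : R| = 2^-1 by rewrite ger0_norm.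
have [|||||l [[sl nl] cl] fix_l] := contraction_fixpoint D F (cnorm h) 0.
- apply: norm_closedI; last exact: norm_closed_commutant.
  by apply: norm_closedI; [exact: norm_closed_star|exact: norm_closed_ball].
- by rewrite h0.
- by split; [rewrite star0 cnorm0|move=> z _; rewrite mulr0 mul0r].
- move=> x [[sx nx] cx]; split; last first.
    move=> z zh; rewrite -scalerAr -scalerAl mulrDr mulrDl zh.
    by rewrite mulrA (cx _ zh) -mulrA (cx _ zh) mulrA.
  split; first by rewrite starZr starD starM sh sx.
  rewrite cnormZr half0; have := cnormD h (x * x); have := cnormM x x.
  have : cnorm x * cnorm x <= cnorm h * cnorm h by rewrite ler_pM ?cnorm_ge0.
  have : cnorm h * cnorm h <= 1 * cnorm h by rewrite ler_wpM2r // ltW.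
  lra.
- move=> x y [[_ nx] _] [[_ ny] _].
  rewrite -scalerBr opprD addrACA subrr add0r cnormZr half0.
  have := nF x y.
  have : (cnorm x + cnorm y) * cnorm (x - y) <= (cnorm h + cnorm h) * cnorm (x - y).
    by rewrite ler_wpM2r ?cnorm_ge0 ?lerD.
  lra.
have hl : h + l * l = l + l.
  have := congr1 (fun u => 2%:R%:C *: u) fix_l.
  rewrite /F scalerA -rmorphM /= divff ?pnatr_eq0 // scale1r => ->.
  by rewrite rmorph_nat scaler_nat mulr2n.
exists (1 - l); split.
- by rewrite starB star1 sl.
- have -> : h = l + l - l * l by rewrite -hl addrK.
  by rewrite mulrBl mul1r mulrBr mulr1 -[l + l - _]addrA [in RHS]opprD addrA.
- by move=> z zh; rewrite mulrBr mulrBl mulr1 mul1r (cl z zh).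
Qed.

End Invertible.

(** * The spectrum of a self-adjoint element *)

Section SelfAdjointSpectrum.
Context {R : realType} {A : cstarAlgType R}.
Implicit Types (b h q x y : A) (z : R[i]).

Lemma sqrt_scale_exists (m : R) h : star h = h -> cnorm h < m -> exists q,
  [/\ star q = q, q * q = m%:C *: 1 - h & forall z : A, z * h = h * z -> z * q = q * z].
Proof.
move=> sh hm; have m0 : 0 < m by apply: le_lt_trans hm; exact: cnorm_ge0.
have [||s [ss s2 sc]] := sqrt_exists (m^-1%:C *: h).
- by rewrite starZr sh.
- by rewrite cnormZr ger0_norm ?invr_ge0 ?ltW // mulrC ltr_pdivrMr // mul1r.
exists ((Num.sqrt m)%:C *: s); split.
- by rewrite starZr ss.
- rewrite -scalerAl -scalerAr scalerA -rmorphM -expr2 sqr_sqrtr ?ltW // s2.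
  by rewrite scalerBr scalerA -rmorphM mulfV ?scale1r // gt_eqF.
- move=> z zh; rewrite -scalerAr -scalerAl sc //.
  by rewrite -scalerAr -scalerAl zh.
Qed.

(* With [w = b + i q], commutation gives [w* w = b^2 + q^2] while [b] is the real
   part of [w]. *)
Lemma cnorm_sqr_le_add_sqr b q : star b = b -> star q = q -> b * q = q * b ->
  cnorm b ^+ 2 <= cnorm (b * b + q * q).
Proof.
move=> sb sq bq; pose w := b + 'i *: q.
have sw : star w = b - 'i *: q.
  rewrite starD starZC sb sq -scaleNr; congr (_ + _ *: _).
  by apply/eqP; rewrite eq_complex /= oppr0 !eqxx.
have -> : b * b + q * q = star w * w.
  rewrite sw /w mulrDr !mulrBl -!scalerAl -!scalerAr scalerA bq.
  have -> : 'i * 'i = -1 :> R[i] by rewrite -expr2 sqr_i.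
  rewrite scaleN1r opprK.
  by rewrite addrA subrK.
rewrite cnorm_star ler_sqr ?nnegrE ?cnorm_ge0 //.
have : (2%:R : R)%:C *: b = w + star w.
  by rewrite sw /w addrACA subrr addr0 rmorph_nat scaler_nat mulr2n.
move/(congr1 cnorm); rewrite cnormZr ger0_norm // => h.
have := cnormD w (star w); rewrite cnorm_starE; lra.
Qed.

(** With [q * q = m - h * h] the element is [(m + t) - q * q], and [cnorm (q * q) <= cnorm (q * q +
    h * h) = m < m + t]. *)
Lemma sqr_add_pos_invertible h (t : R) : star h = h -> 0 < t ->
  invertible (h * h + t%:C *: 1).
Proof.
move=> sh t0; pose m := cnorm (h * h) + 1.
have shh : star (h * h) = h * h by rewrite starM sh.
have m0 : 0 <= m by rewrite addr_ge0 ?cnorm_ge0.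
have [|q [sq q2 cq]] := sqrt_scale_exists m (h * h) shh; first by rewrite ltrDl.
have hq : h * q = q * h by apply: cq; rewrite mulrA.
have -> : h * h + t%:C *: 1 = (m + t)%:C *: 1 - q * q.
  by rewrite q2 opprB rmorphD scalerDl [RHS]addrC addrA subrK.
have mt : 0 <= m + t by rewrite addr_ge0 // ltW.
apply: neumann_scale; rewrite cabsr ger0_norm //.
apply: (@le_lt_trans _ _ m); last by rewrite ltrDl.
have := cnorm_sqr_le_add_sqr q h sq sh (esym hq).
rewrite -cnorm_sqr_sa // expr2 {2}q2 subrK cnormZr cnorm1 mulr1.
by rewrite ger0_norm.
Qed.

Lemma mul_add_sub_scale x (c : R[i]) :
  (x + c *: 1) * (x - c *: 1) = x * x - (c * c) *: 1.
Proof.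
rewrite mulrBr !mulrDl -!scalerAl mul1r -scalerAr mulr1 mul1r scalerA.
by rewrite opprD addrA addrK.
Qed.

(** For [l = r + i t] and [h = b - r], the product of [l - b = - h + i t] with the commuting factor
    [- h - i t] is [h * h + t ^+ 2], which is invertible if [t] is nonzero. *)
Lemma spectrum_sa_real b (l : R[i]) : star b = b -> spectrum b l ->
  complex.Im l = 0.
Proof.
move=> sb sl; apply/eqP; apply: contrapT => /negP t0; apply: sl.
pose r := complex.Re l; pose t := complex.Im l; pose h := b - r%:C *: 1.
have sh : star h = h by rewrite starB starZr star1 sb.
have E1 : l *: 1 - b = - h + (t%:C * 'i) *: 1.
  rewrite opprB addrAC -scalerDl; congr (_ *: _ - _).
  by rewrite {1}[l]complexE mulrC.
have cc : (t%:C * 'i) * (t%:C * 'i) = - (t ^+ 2)%:C :> R[i].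
  by rewrite mulrACA -expr2 -expr2 sqr_i mulrN1 rmorphXn.
have E2 : (- h + (t%:C * 'i) *: 1) * (- h - (t%:C * 'i) *: 1)
    = h * h + (t ^+ 2)%:C *: 1.
  by rewrite mul_add_sub_scale mulrNN cc scaleNr opprK.
have E3 : (- h - (t%:C * 'i) *: 1) * (- h + (t%:C * 'i) *: 1)
    = h * h + (t ^+ 2)%:C *: 1.
  rewrite -[X in _ * (_ + X)]opprK -scaleNr mul_add_sub_scale.
  by rewrite mulrNN mulrNN cc scaleNr opprK.
rewrite E1; apply: (invertible_mulVl _ (- h - (t%:C * 'i) *: 1)).
  by rewrite E2 E3.
by rewrite E2; apply: sqr_add_pos_invertible => //; rewrite exprn_even_gt0.
Qed.

(** An inverse [d] of [n - b * b] would leave a margin: [n - e - b * b] is [q * q] for a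
    self-adjoint [q] commuting with [b]. Then [n = cnorm b ^+ 2 <= cnorm (b * b + q * q) = |n - e|],
    although [0 < e <= n / 2]. *)
Lemma norm_in_spectrum_sqr b : star b = b ->
  ~ invertible ((cnorm b ^+ 2)%:C *: 1 - b * b).
Proof.
move=> sb [d [d1 d2]]; set n := cnorm b ^+ 2 in d1 d2.
have n0 : 0 <= n by rewrite sqr_ge0.
have nN0 : n != 0.
  apply/negP; rewrite sqrf_eq0 => /eqP/cnorm0_eq0 b0; apply: not_invertible0.
  by exists d; move: d1 d2; rewrite /n b0 cnorm0 expr0n scale0r mulr0 subr0.
have ni0 : 0 <= n^-1 by rewrite invr_ge0.
(* The first term of [K] dominates the norm of the inverse [d'] below, the second gives
   [e <= n / 2]; moreover [K^-1 = 2 * e]. *)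
pose K := 2 * (cnorm d + 1) + n^-1; pose e := (2 * K)^-1.
have d0 := cnorm_ge0 d; have K0 : 0 < K by rewrite /K; lra.
have e0 : 0 < e by rewrite invr_gt0 mulr_gt0.
have eK : e * K = 2^-1 by rewrite /e; field; rewrite gt_eqF.
have nb : cnorm (b * b) = n by rewrite -expr2 cnorm_sqr_sa.
have sbb : star (b * b) = b * b by rewrite starM sb.
have nbe : cnorm (b * b) < n + e by rewrite nb ltrDl.
have [s [ss s2 cs]] := sqrt_scale_exists (n + e) (b * b) sbb nbe.
have [d' [dd1 dd2]] : invertible ((n + e)%:C *: 1 - b * b).
  by apply: neumann_scale; rewrite cabsr ger0_norm ?addr_ge0 // ltW.
have comm_d' (z : A) : z * (b * b) = (b * b) * z -> z * d' = d' * z.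
  move=> zb; apply: (invertible_commute _ _ _ dd1 dd2).
  by rewrite mulrBr mulrBl zb -scalerAr -scalerAl mul1r mulr1.
have sd' : star d' = d'.
  have h : star d' * ((n + e)%:C *: 1 - b * b) = 1.
    by have := congr1 star dd1; rewrite starM starB starZr star1 sbb.
  by rewrite -[star d']mulr1 -dd1 mulrA h mul1r.
have nd' : cnorm d' < K.
  (* Resolvent identity; as [e * cnorm d <= 1 / 2], it yields [cnorm d' <= 2 * cnorm d]. *)
  have E : d' = d - e%:C *: (d * d').
    have -> : e%:C *: (d * d')
        = d * (((n + e)%:C *: 1 - b * b) - (n%:C *: 1 - b * b)) * d'.
      rewrite opprB addrA subrK rmorphD scalerDl addrAC subrr add0r.
      by rewrite -scalerAr mulr1 -scalerAl.
    by rewrite mulrBr mulrBl -mulrA dd1 mulr1 d2 mul1r subKr.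
  have : cnorm d' <= cnorm d + e * (cnorm d * cnorm d').
    rewrite {1}E; apply: le_trans (cnormB _ _) _.
    by rewrite lerD2l cnormZr (ger0_norm (ltW e0)) ler_wpM2l ?cnormM ?(ltW e0).
  have : e * cnorm d <= e * K by apply: ler_wpM2l; [exact: ltW|rewrite /K; lra].
  rewrite eK.
  have dd0 := cnorm_ge0 d'; move: dd0 d0; rewrite /K.
  move: (cnorm d) (cnorm d') => u v v0 u0 eu; rewrite mulrA => h.
  have : e * u * v <= 2^-1 * v by apply: ler_wpM2r.
  lra.
have [r [sr r2 cr]] := sqrt_scale_exists K d' sd' nd'.
have rs : s * r = r * s.
  by apply: cr; apply: comm_d'; apply/esym/cs.
(* [q * q] is [K^-1] times [(n + e - b * b) * (K - d')], where [d'] inverts the first factor. *)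
pose q := (Num.sqrt K^-1)%:C *: (s * r).
have sq : star q = q by rewrite starZr starM ss sr -rs.
have bbb : b * (b * b) = b * b * b by rewrite mulrA.
have bq : b * q = q * b.
  rewrite -scalerAr -scalerAl mulrA (cs b bbb) -mulrA.
  by rewrite (cr b (comm_d' b bbb)) mulrA.
have q2 : q * q = (n + e - K^-1)%:C *: 1 - b * b.
  rewrite -scalerAl -scalerAr scalerA -rmorphM -expr2 sqr_sqrtr ?invr_ge0 ?ltW //.
  have -> : s * r * (s * r) = s * s * (r * r) by rewrite mulrA -(mulrA s) -rs !mulrA.
  rewrite s2 r2 mulrBr dd1 -scalerAr mulr1 scalerBr scalerA -rmorphM mulVf ?gt_eqF //.
  by rewrite scale1r rmorphB scalerBl addrAC.
have := cnorm_sqr_le_add_sqr b q sb sq bq.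
rewrite q2 addrC subrK cnormZr cnorm1 mulr1 -/n.
have Ki : K^-1 = 2 * e by rewrite /e; field; rewrite gt_eqF.
have en : e * n^-1 <= e * K.
  by apply: ler_wpM2l; [exact: ltW|rewrite /K; lra].
move: en; rewrite eK ler_pdivrMr ?lt_def ?nN0 // Ki ler_normr => en.
by case/orP; lra.
Qed.

(** [cnorm b ^+ 2 - b * b] is the product of [cnorm b - b] and [cnorm b + b], which therefore are
    not both invertible. *)
Lemma norm_in_spectrum b : star b = b ->
  exists2 l, spectrum b l & cabs l = cnorm b.
Proof.
move=> sb; have nb := cnorm_ge0 b.
have [s1|] := pselect (spectrum b (cnorm b)%:C).
  by exists (cnorm b)%:C; rewrite // cabsr ger0_norm.
have [s2|] := pselect (spectrum b (- cnorm b)%:C).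
  by exists (- cnorm b)%:C; rewrite // cabsr normrN ger0_norm.
move=> /contrapT i2 /contrapT i1.
case: (norm_in_spectrum_sqr b sb).
have -> : (cnorm b ^+ 2)%:C *: 1 - b * b
    = ((cnorm b)%:C *: 1 - b) * - ((- cnorm b)%:C *: 1 - b).
  rewrite rmorphN scaleNr opprB opprK; set c := (cnorm b)%:C *: 1.
  have cb : b * c = c * b by rewrite -scalerAr -scalerAl mulr1 mul1r.
  have -> : (cnorm b ^+ 2)%:C *: 1 = c * c.
    by rewrite -scalerAl mul1r scalerA -rmorphM expr2.
  by rewrite mulrBl !mulrDr cb (addrC (c * b)) opprD addrA addrAC addrK.
by apply: invertibleM => //; exact: invertibleN.
Qed.

Lemma spectrum_open_compl y (z : R[i]) : ~ spectrum y z ->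
  exists2 d : R, 0 < d & forall w, cabs (w - z) < d -> ~ spectrum y w.
Proof.
move=> /contrapT [u [h1 h2]]; exists (cnorm u + 1)^-1.
  by rewrite invr_gt0 ltr_wpDl ?cnorm_ge0.
move=> w wz; suff : invertible (w *: 1 - y) by move=> ?; apply.
have -> : w *: 1 - y = (z *: 1 - y) * (1 - (z - w) *: u).
  by rewrite mulrBr mulr1 -scalerAr h1 addrAC -scalerBl subKr.
apply: invertibleM; first by exists u.
have c0 : 0 < cnorm u + 1 by rewrite ltr_wpDl ?cnorm_ge0.
apply: neumann; rewrite cnormZ -cabsN opprB.
move: wz; rewrite -[_^-1]mul1r ltr_pdivlMr // => wz; apply: le_lt_trans wz.
by rewrite ler_wpM2l ?cabs_ge0 ?lerDl.
Qed.

(** [r = l - p] splits into linear factors. If no root were in the spectrum, each factor would be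
    invertible at [y], and so would their product. *)
Lemma spectral_mapping y (p : {poly R[i]}) (l : R[i]) :
  spectrum y !=set0 -> spectrum (horner_alg y p) l ->
  exists2 z, spectrum y z & p.[z] = l.
Proof.
move=> [z0 sz0] sl; pose r := l%:P - p.
have rE z : r.[z] = l - p.[z] by rewrite hornerD hornerN hornerC.
suff [z sz rz] : exists2 z, spectrum y z & r.[z] = 0.
  by exists z => //; apply/eqP; rewrite eq_sym -subr_eq0 -rE rz.
have rA : horner_alg y r = l *: 1 - horner_alg y p.
  by rewrite rmorphB /= horner_algC.
have [s rs] := closed_field_poly_normal r.
(* If [p] is the constant [l], then [r = 0] and any point of the nonempty spectrum serves. *)
have [r0|rN0] := eqVneq (lead_coef r) 0.
  by exists z0 => //; rewrite rs r0 scale0r horner0.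
have rs_root z : z \in s -> r.[z] = 0.
  move=> zs; rewrite rs hornerZ; apply/eqP; rewrite mulf_eq0; apply/orP; right.
  by rewrite -[_ == 0]/(root _ z) root_prod_XsubC.
apply: contrapT => noz; apply: sl; rewrite -rA rs linearZ /= mulr_algl.
apply: invertibleZ => //.
have {rs_root noz} all_inv z : z \in s -> invertible (z *: 1 - y).
  by move=> zs; apply: contrapT => sz; apply: noz; exists z => //; exact: rs_root.
elim: s all_inv {rs} => [|z s IH] all_inv.
  by rewrite big_nil rmorph1; exact: invertible1.
rewrite big_cons rmorphM /=; apply: invertibleM.
  rewrite rmorphB /= horner_algX horner_algC -opprB; apply: invertibleN.
  by apply: all_inv; rewrite mem_head.
by apply: IH => w ws; apply: all_inv; rewrite inE ws orbT.
Qed.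

Lemma star_horner_alg y (p : {poly R[i]}) : star y = y ->
  star (horner_alg y p) = horner_alg y (map_poly conjc p).
Proof.
move=> sy; elim/poly_ind: p => [|p c IH]; first by rewrite map_poly0 !rmorph0 star0.
rewrite !rmorphD !rmorphM /= map_polyX map_polyC /= !horner_algX !horner_algC.
rewrite starD starM starZC star1 sy IH; congr (_ + _).
by rewrite -[X in X * _](horner_algX y) -[X in _ = _ * X](horner_algX y) -!rmorphM mulrC.
Qed.

Lemma horner_map_conjc (p : {poly R[i]}) (z : R[i]) :
  (map_poly conjc p).[z^*%C] = (p.[z])^*%C.
Proof. exact: horner_map. Qed.

(** [q] evaluates at [y] to a self-adjoint element of norm [cnorm (horner_alg y p) ^+ 2], which is
    [|q(z)|] for some [z] in the spectrum; as [z] is real, [q(z) = |p(z)|^2]. *)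
Lemma norm_horner_alg y (p : {poly R[i]}) : star y = y ->
  exists2 z, spectrum y z & cnorm (horner_alg y p) = cabs p.[z].
Proof.
move=> sy; pose q := map_poly conjc p * p.
have qE : horner_alg y q = star (horner_alg y p) * horner_alg y p.
  by rewrite star_horner_alg // rmorphM.
have sq : star (horner_alg y q) = horner_alg y q by rewrite qE starM starK.
have [l sl nl] := norm_in_spectrum (horner_alg y q) sq.
have y0 : spectrum y !=set0.
  by have [z sz _] := norm_in_spectrum y sy; exists z.
have [z sz qz] := spectral_mapping y q l y0 sl.
exists z => //.
have zz : z^*%C = z.
  have := spectrum_sa_real y z sy sz.
  by case: (z) => u v /= ->; rewrite oppr0.
move: nl; rewrite qE cnorm_star -qz hornerM -{1}zz horner_map_conjc cabsM cabs_conj.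
by rewrite -expr2 => /esym/eqP; rewrite eqrXn2 ?cabs_ge0 ?cnorm_ge0 // => /eqP.
Qed.

End SelfAdjointSpectrum.

(** * Bernstein polynomials *)

Section Bernstein.
Context {R : realType}.
Implicit Types (f : nat -> R[i]).

(* The Bernstein operator [f |-> \sum_k 'C(n, k) f(k) X^k (1 - X)^(n - k)], by
   conditioning on the first of [n] coin flips. *)
Fixpoint bernstein n f : {poly R[i]} :=
  if n is n'.+1 then
    (1 - 'X) * bernstein n' f + 'X * bernstein n' (fun k => f k.+1)
  else (f 0%N)%:P.

(** The factor of [L] in the bound is the mean of [(k + a) ^+ 2] for a binomial [k] with parameters
    [n] and [s]. In the induction the shift [a] absorbs the first coin flip. *)
Lemma bernstein_dist n f (g : R[i]) (s a e L : R) : 0 <= s <= 1 ->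
  (forall k, cabs (f k - g) <= e + L * (k%:R + a) ^+ 2) ->
  cabs ((bernstein n f).[s%:C] - g)
  <= e + L * ((n%:R * s + a) ^+ 2 + n%:R * s * (1 - s)).
Proof.
move=> /andP[s0 s1]; elim: n f a => [|n IH] f a fg.
  by rewrite /= hornerC; have := fg 0%N; rewrite !mul0r !add0r addr0.
have h1 := IH f a fg.
have h2 : cabs ((bernstein n (fun k => f k.+1)).[s%:C] - g)
    <= e + L * ((n%:R * s + (a + 1)) ^+ 2 + n%:R * s * (1 - s)).
  by apply: IH => k; have := fg k.+1; rewrite -natr1 addrAC addrA.
rewrite /= hornerD !hornerM hornerD hornerN hornerX hornerC.
move: h1 h2; set u := _.[_]; set v := _.[_] => h1 h2.
have -> : (1 - s%:C) * u + s%:C * v - g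
    = (1 - s)%:C * (u - g) + s%:C * (v - g) by rewrite rmorphB rmorph1; ring.
apply: le_trans (cabsD _ _) _.
rewrite !cabsM !cabsr (ger0_norm s0) (@ger0_norm _ (1 - s)) ?subr_ge0 //.
have h3 := ler_wpM2l s0 h2.
have s1' : 0 <= 1 - s by rewrite subr_ge0.
have h4 := ler_wpM2l s1' h1.
apply: le_trans (lerD h4 h3) _; rewrite -natr1 le_eqVlt.
by apply/orP; left; apply/eqP; ring.
Qed.

End Bernstein.

(** * Weierstrass approximation on a compact set of reals *)

Section Weierstrass.
Context {R : realType} (K : set R) (G : R -> R[i]).
Hypothesis K_compact : compact K.
Hypothesis G_cts : forall t (e : R), K t -> 0 < e ->
  exists2 d : R, 0 < d & forall s, K s -> `|s - t| < d -> cabs (G s - G t) < e.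

(** Heine-Cantor. Compactness enters as near covering: what holds around each point of [K] for all
    small [d] holds on all of [K] for all small [d]. *)
Lemma compact_unif_cts (e : R) : 0 < e -> exists2 d : R, 0 < d &
  forall s t, K s -> K t -> `|s - t| < d -> cabs (G s - G t) < e.
Proof.
move=> e0; have := K_compact; rewrite compact_near_coveringP => ncov.
have /nbhs_ballP[d /= d0 H] : \forall d \near (0 : R)^'+, K `<=` (fun s => K s ->
    forall t, K t -> `|s - t| < d -> cabs (G s - G t) < e).
  apply: ncov => x Kx.
  have [d d0 H] := G_cts x (e / 2) Kx (divr_gt0 e0 (ltr0n _ 2)).
  have d20 : 0 < d / 2 by rewrite divr_gt0.
  exists (ball x (d / 2), [set c | c < d / 2]) => /=.
    by split; [exact: nbhsx_ballx|exact: nbhs_right_lt].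
  move=> [s c] /= [xs cd] Ks t Kt st.
  have sx : `|s - x| < d / 2 by rewrite distrC.
  have -> : G s - G t = (G s - G x) - (G t - G x) by ring.
  apply: le_lt_trans (cabsD _ _) _; rewrite cabsN.
  have : cabs (G s - G x) < e / 2 by apply: H => //; lra.
  have : cabs (G t - G x) < e / 2.
    apply: H => //; apply: le_lt_trans (ler_distD s _ _) _.
    by rewrite (distrC t); lra.
  lra.
exists (d / 2); first by rewrite divr_gt0.
move=> s t Ks Kt st; apply: (H (d / 2)) => //=.
  by rewrite -ball_normE /= sub0r normrN ger0_norm; lra.
by lra.
Qed.

Lemma compact_cts_bounded : exists2 B : R, 0 <= B & forall t, K t -> cabs (G t) <= B.
Proof.
have := K_compact; rewrite compact_near_coveringP => ncov.
have : \forall B \near +oo, K `<=` (fun t => K t -> cabs (G t) <= B).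
  apply: ncov => x Kx.
  have [d d0 H] := G_cts x 1 Kx ltr01.
  exists (ball x d, [set B | cabs (G x) + 1 < B]) => /=.
    split; first exact: nbhsx_ballx.
    by exists (cabs (G x) + 1); split => //; exact: num_real.
  move=> [s B] /= [xs cB] Ks.
  have := H s Ks; rewrite distrC => /(_ xs) h.
  rewrite -[G s](subrK (G x)); apply: le_trans (cabsD _ _) _; lra.
move=> [B [_ HB]]; exists (Num.max 0 (B + 1)); first by rewrite le_max lexx.
by move=> t Kt; apply: HB => //; rewrite lt_max ltrDl ltr01 orbT.
Qed.

Lemma almost_nearest (x e : R) : K !=set0 -> 0 < e ->
  exists2 t, K t & forall s, K s -> `|x - t| <= `|x - s| + e.
Proof.
move=> [t0 Kt0] e0; pose D := [set `|x - s| | s in K].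
have infD : has_inf D.
  split; first by exists `|x - t0|, t0.
  by exists 0 => _ [s _ <-].
have [_ [t Kt <-] te] := inf_adherent e0 infD.
exists t => // s Ks; rewrite (le_trans (ltW te)) // lerD2r.
by apply: ge_inf; [exact: infD.2|exists s].
Qed.

(* Sampling [G] in almost nearest points of [K] to the nodes replaces the
   extension of [G] to an interval. *)
Lemma weierstrass_compact (e : R) : 0 < e ->
  exists p : {poly R[i]}, forall t, K t -> cabs (p.[t%:C] - G t) <= e.
Proof.
move=> e0; have [K0|K0] := pselect (K !=set0); last first.
  by exists 0 => t Kt; case: K0; exists t.
have [M M0 KM] : exists2 M : R, 0 < M & forall t, K t -> `|t| <= M.
  have [M [_ HM]] := compact_bounded K_compact.
  exists (Num.max 1 (M + 1)); first by rewrite lt_max ltr01.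
  by move=> t Kt; apply: HM => //; rewrite lt_max ltrDl ltr01 orbT.
have [B B0 GB] := compact_cts_bounded.
have e20 : 0 < e / 2 by rewrite divr_gt0.
have [d d0 dG] := compact_unif_cts (e / 2) e20.
(* Since [node k - t = 2 M (k - n s) / n], this [C] makes the quadratic term of [dist] equal to
   [32 B / d^2] times [|node k - t|^2], which is at least [2 B] for nodes at distance [d / 4] or
   more. *)
pose C := 128 * B * M ^+ 2 / d ^+ 2.
have C0 : 0 <= C by rewrite /C divr_ge0 ?sqr_ge0 // mulr_ge0 ?sqr_ge0 // mulr_ge0.
pose n := (Num.bound (2 * C / e)).+1.
have n0 : 0 < n%:R :> R by [].
have Cn : C / n%:R <= e / 2.
  have : 2 * C / e < n%:R.
    have h : 0 <= 2 * C / e by rewrite divr_ge0 ?(ltW e0) // mulr_ge0.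
    by apply: lt_trans (archi_boundP h) _; rewrite ltr_nat.
  by rewrite ltr_pdivrMr // ler_pdivrMr //; lra.
pose node k : R := 2 * M * k%:R / n%:R - M.
have d40 : 0 < d / 4 by rewrite divr_gt0.
have /choice[t_ ht] k : exists t, K t /\
    forall s, K s -> `|node k - t| <= `|node k - s| + d / 4.
  by have [t Kt ht] := almost_nearest (node k) (d / 4) K0 d40; exists t.
pose q := bernstein n (G \o t_).
pose lin : {poly R[i]} := (2 * M)^-1%:C *: ('X + (M%:C)%:P).
exists (q \Po lin) => t Kt; pose s := (t + M) / (2 * M).
have linE : lin.[t%:C] = s%:C.
  by rewrite hornerZ hornerD hornerX hornerC -rmorphD -rmorphM mulrC.
rewrite horner_comp linE.
have /andP[tM1 tM2] : - M <= t <= M by rewrite -ler_norml KM.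
have s01 : 0 <= s <= 1.
  by rewrite /s divr_ge0 ?ler_pdivrMr ?mulr_gt0 //=; lra.
have dist k : cabs ((G \o t_) k - G t) <= e / 2 + C / n%:R ^+ 2 * (k%:R - n%:R * s) ^+ 2.
  have [Kk hk] := ht k; have := hk t Kt => near_k.
  have L0 : 0 <= C / n%:R ^+ 2 * (k%:R - n%:R * s) ^+ 2.
    by apply: mulr_ge0; [apply: divr_ge0 => //|]; exact: sqr_ge0.
  (* The sample for a close node is within [3 d / 4] of [t]. *)
  have [close|far] := ltP `|node k - t| (d / 4).
    rewrite ler_wpDr //; apply/ltW/dG => //.
    apply: le_lt_trans (ler_distD (node k) _ _) _; rewrite (distrC (t_ k)); lra.
  rewrite ler_wpDl ?(ltW e20) //; apply: (@le_trans _ _ (2 * B)).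
    apply: le_trans (cabsD _ _) _; rewrite cabsN.
    by have := GB _ Kk; have := GB _ Kt; rewrite /=; lra.
  have -> : C / n%:R ^+ 2 * (k%:R - n%:R * s) ^+ 2
      = 32 * B / d ^+ 2 * `|node k - t| ^+ 2.
    rewrite real_normK ?num_real // /C /node /s; field.
    by rewrite !gt_eqF.
  have : (d / 4) ^+ 2 <= `|node k - t| ^+ 2 by rewrite ler_pXn2r ?nnegrE ?(ltW d40).
  move: (`|node k - t| ^+ 2) => m hm.
  have Bd : 0 <= 32 * B / d ^+ 2 by rewrite divr_ge0 ?sqr_ge0 // mulr_ge0.
  apply: le_trans (ler_wpM2l Bd hm); rewrite le_eqVlt; apply/orP; left; apply/eqP.
  by field; rewrite gt_eqF.
(* The shift [- (n * s)] cancels the mean; the variance contributes at most [C / n <= e / 2]. *)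
apply: le_trans (bernstein_dist n _ _ s (- (n%:R * s)) _ _ s01 dist) _.
rewrite subrr expr0n add0r.
have : C / n%:R ^+ 2 * (n%:R * s * (1 - s)) <= C / n%:R.
  have -> : C / n%:R ^+ 2 * (n%:R * s * (1 - s)) = C / n%:R * (s * (1 - s)).
    by field; rewrite gt_eqF.
  rewrite -[leRHS]mulr1 ler_wpM2l ?divr_ge0 ?(ltW n0) //; case/andP: s01 => ? ?; nra.
lra.
Qed.

End Weierstrass.

(** * Continuous functional calculus of a self-adjoint element *)

Section FunctionalCalculus.
Context {R : realType} {A : cstarAlgType R} (y : A).
Hypothesis y_sa : star y = y.
Implicit Types (b c : A) (g h : R[i] -> R[i]) (p q : {poly R[i]}).

Local Notation ev := (horner_alg y).

Let sp_real z : spectrum y z -> z = (complex.Re z)%:C.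
Proof. by move=> sz; have := spectrum_sa_real y z y_sa sz; case: (z) => u v /= ->. Qed.

(** The spectrum is real, bounded by the norm and has an open complement, so it is a compact set of
    reals. *)
Lemma spectrum_sa_approx g : continuous_on_spectrum y g -> forall e : R, 0 < e ->
  exists p, forall z, spectrum y z -> cabs (p.[z] - g z) <= e.
Proof.
move=> cg e e0; pose K : set R := [set t | spectrum y t%:C].
have K_compact : compact K.
  apply: (@subclosed_compact _ _ `[- cnorm y, cnorm y]).
  - rewrite -(setCK K); apply: open_closedC; rewrite openE => t Kt.
    have [d d0 H] := spectrum_open_compl y t%:C Kt.
    apply/nbhs_ballP; exists d => // s; rewrite -ball_normE /= => ts.
    by apply: H; rewrite -rmorphB cabsr distrC.
  - exact: segment_compact.
  - move=> t /spectrum_le_norm; rewrite cabsr ler_norml.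
    by rewrite /= in_itv.
have [|p hp] := weierstrass_compact K (fun t => g t%:C) K_compact _ e e0.
  move=> t eps Kt eps0.
  have [d d0 H] := continuous_on_spectrum_dist y g _ eps cg Kt eps0.
  by exists d => // s Ks st; apply: H => //; rewrite -rmorphB cabsr.
by exists p => z sz; rewrite (sp_real z sz); apply: hp; rewrite /K /= -sp_real.
Qed.

(* [b] is the limit of [p(y)] along polynomials [p] converging to [g] uniformly on
   the spectrum. *)
Let calc g b := forall e : R, 0 < e -> exists2 p,
  forall z, spectrum y z -> cabs (p.[z] - g z) <= e & cnorm (ev p - b) <= e.

Let norm_ev_le p (e : R) : (forall z, spectrum y z -> cabs p.[z] <= e) ->
  cnorm (ev p) <= e.
Proof. by move=> h; have [z sz ->] := norm_horner_alg y p y_sa; exact: h. Qed.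

Let calc_inj g h b c : (forall z, spectrum y z -> g z = h z) ->
  calc g b -> calc h c -> b = c.
Proof.
move=> gh gb hc; apply/eqP; rewrite -subr_eq0; apply/eqP.
apply: (eq0_of_norm_le 4) => e e0.
have [p p1 p2] := gb e e0; have [q q1 q2] := hc e e0.
apply: le_trans (cnorm_triangle (ev p) _ _) _; rewrite cnorm_dist.
have := cnorm_triangle (ev q) (ev p) c.
have : cnorm (ev p - ev q) <= 2 * e.
  rewrite -rmorphB; apply: norm_ev_le => z sz; rewrite hornerD hornerN.
  have -> : p.[z] - q.[z] = (p.[z] - g z) - (q.[z] - h z) by rewrite gh //; ring.
  apply: le_trans (cabsD _ _) _; rewrite cabsN.
  by have := p1 z sz; have := q1 z sz; lra.
lra.
Qed.

Let calc_ext g h b : (forall z, spectrum y z -> g z = h z) -> calc g b -> calc h b.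
Proof.
by move=> gh gb e e0; have [p p1 p2] := gb e e0; exists p => // z sz; rewrite -gh // p1.
Qed.

Let calc_poly p : calc (horner p) (ev p).
Proof.
by move=> e e0; exists p => [z _|]; rewrite subrr ?cabs0 ?cnorm0 ltW.
Qed.

Let calcD g h b c : calc g b -> calc h c -> calc (fun z => g z + h z) (b + c).
Proof.
move=> gb hc e e0; have e20 : 0 < e / 2 by rewrite divr_gt0.
have [p p1 p2] := gb _ e20; have [q q1 q2] := hc _ e20; exists (p + q).
  move=> z sz; rewrite hornerD opprD addrACA; apply: le_trans (cabsD _ _) _.
  by have := p1 z sz; have := q1 z sz; lra.
by rewrite rmorphD opprD addrACA; apply: le_trans (cnormD _ _) _; lra.
Qed.

Let calc_star g b : calc g b -> calc (fun z => (g z)^*%C) (star b).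
Proof.
move=> gb e e0; have [p p1 p2] := gb e e0; exists (map_poly conjc p).
  move=> z sz; have := p1 z sz; rewrite -cabs_conj rmorphB /=.
  have zz : z^*%C = z by rewrite (sp_real z sz) conjc_real.
  by rewrite -horner_map_conjc zz.
by rewrite -star_horner_alg // -starB cnorm_starE.
Qed.

(** Products need bounded factors; the bound comes from an approximating polynomial, since
    [cabs z <= cnorm y] on the spectrum. *)
Let calc_bounded g b : calc g b ->
  exists2 B : R, 0 <= B & forall z, spectrum y z -> cabs (g z) <= B.
Proof.
move=> gb; have [p p1 _] := gb 1 ltr01.
have [B B0 HB] : exists2 B : R, 0 <= B &
    forall z, spectrum y z -> cabs p.[z] <= B.
  elim/poly_ind: p {p1} => [|p c [B B0 HB]].
    by exists 0 => // z _; rewrite horner0 cabs0.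
  have n0 := cnorm_ge0 y; have c0 := cabs_ge0 c.
  exists (B * cnorm y + cabs c) => [|z sz]; first by rewrite addr_ge0 ?mulr_ge0.
  rewrite hornerD hornerM hornerX hornerC; apply: le_trans (cabsD _ _) _.
  by rewrite lerD2r cabsM ler_pM ?cabs_ge0 ?HB ?spectrum_le_norm.
exists (B + 1) => [|z sz]; first by rewrite addr_ge0.
have -> : g z = p.[z] - (p.[z] - g z) by ring.
apply: le_trans (cabsD _ _) _; rewrite cabsN.
by have := p1 z sz; have := HB z sz; lra.
Qed.

Let calcM g h b c : calc g b -> calc h c -> calc (fun z => g z * h z) (b * c).
Proof.
move=> gb hc e e0; have [B B0 gB] := calc_bounded g b gb.
have [C C0 hC] := calc_bounded h c hc.
have b0 := cnorm_ge0 b; have c0 := cnorm_ge0 c.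
pose D := B + C + cnorm b + cnorm c + 1.
have D0 : 0 < D by rewrite /D; lra.
have eD0 : 0 < e / D by rewrite divr_gt0.
(* [e' <= 1] makes products of two errors linear in [e'], and [D] dominates the resulting
   coefficients. *)
have [e' [e'0 e'1 e'e]] : exists e' : R, [/\ 0 < e', e' <= 1 & e' * D <= e].
  exists (Num.min 1 (e / D)); split; first by rewrite lt_min ltr01.
    by rewrite ge_min lexx.
  by rewrite -ler_pdivlMr // ge_min lexx orbT.
have prod (u v u1 v1 : R) : 0 <= u -> u <= e' -> 0 <= v -> v <= e' -> 0 <= u1 ->
    0 <= v1 -> u1 + v1 + 1 <= D -> u * (v1 + v) + u1 * v <= e.
  move=> u0 ue v0 ve u10 v10 uv; apply: le_trans e'e.
  have : u * (v1 + v) <= e' * (v1 + 1) by rewrite ler_pM //; lra.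
  have : u1 * v <= u1 * e' by rewrite ler_wpM2l.
  have : e' * (u1 + v1 + 1) <= e' * D by rewrite ler_wpM2l // ltW.
  lra.
have [p p1 p2] := gb _ e'0; have [q q1 q2] := hc _ e'0; exists (p * q).
  move=> z sz; rewrite hornerM.
  have -> : p.[z] * q.[z] - g z * h z
    = (p.[z] - g z) * (h z + (q.[z] - h z)) + g z * (q.[z] - h z) by ring.
  apply: le_trans (cabsD _ _) _; rewrite !cabsM.
  apply: (@le_trans _ _ (cabs (p.[z] - g z) * (C + cabs (q.[z] - h z))
                         + B * cabs (q.[z] - h z))).
    rewrite lerD ?ler_wpM2r ?ler_wpM2l ?cabs_ge0 ?gB //.
    by apply: le_trans (cabsD _ _) _; rewrite lerD2r hC.
  by apply: prod; rewrite ?cabs_ge0 ?p1 ?q1 // /D; lra.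
rewrite rmorphM /=.
have -> : ev p * ev q - b * c = (ev p - b) * (c + (ev q - c)) + b * (ev q - c).
  by rewrite (addrC c) subrK mulrBl mulrBr addrA subrK.
apply: le_trans (cnormD _ _) _.
apply: (@le_trans _ _ (cnorm (ev p - b) * (cnorm c + cnorm (ev q - c))
                       + cnorm b * cnorm (ev q - c))).
  rewrite lerD ?cnormM //; apply: le_trans (cnormM _ _) _.
  by rewrite ler_wpM2l ?cnorm_ge0 ?cnormD.
by apply: prod; rewrite ?cnorm_ge0 // /D; lra.
Qed.

(** Polynomials with error [1 / (n + 1)] on the spectrum become a Cauchy sequence when evaluated at
    [y]. *)
Let calc_exists g : continuous_on_spectrum y g -> exists b, calc g b.
Proof.
move=> /spectrum_sa_approx approx.
have e0 n : 0 < n.+1%:R^-1 :> R by rewrite invr_gt0.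
have /choice[p hp] n := approx _ (e0 n).
have small (e : R) : 0 < e -> exists N, forall n, (N <= n)%N -> n.+1%:R^-1 <= e.
  move=> ep; have ie : 0 <= e^-1 by rewrite invr_ge0 ltW.
  exists (Num.bound e^-1) => n Nn; rewrite invf_ple ?posrE //.
  apply: le_trans (ltW (archi_boundP ie)) _.
  by rewrite ler_nat (leq_trans Nn).
have cauchy m n (e : R) : m.+1%:R^-1 <= e -> n.+1%:R^-1 <= e ->
    cnorm (ev (p m) - ev (p n)) <= 2 * e.
  move=> me ne; rewrite -rmorphB; apply: norm_ev_le => z sz.
  rewrite hornerD hornerN.
  have -> : (p m).[z] - (p n).[z] = ((p m).[z] - g z) - ((p n).[z] - g z) by ring.
  apply: le_trans (cabsD _ _) _; rewrite cabsN.
  by have := le_trans (hp m z sz) me; have := le_trans (hp n z sz) ne; lra.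
have [|b hb] := cnorm_complete (fun n => ev (p n)).
  move=> e ep; have [N hN] := small (e / 3) (divr_gt0 ep (ltr0n _ 3)).
  exists N => m n Nm Nn; apply: le_lt_trans (cauchy m n (e / 3) (hN _ Nm) (hN _ Nn)) _.
  lra.
exists b => e ep; have [N hN] := small e ep; have [N' hN'] := hb e ep.
exists (p (maxn N N')) => [z sz|]; last by apply/ltW/hN'; rewrite leq_maxr.
by apply: le_trans (hp _ z sz) _; apply: hN; rewrite leq_maxl.
Qed.

Lemma functional_calculus_exists : exists Phi, functional_calculus y Phi.
Proof.
pose Phi g := xget 0 [set b | calc g b].
have PhiE g b : calc g b -> Phi g = b.
  by move=> gb; apply: xget_unique => // c gc; exact: (calc_inj g g).
have PhiP g : continuous_on_spectrum y g -> calc g (Phi g).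
  by move=> /calc_exists[b gb]; rewrite (PhiE _ _ gb).
exists Phi; split.
- move=> g h cg gh; apply/esym/PhiE; apply: calc_ext (PhiP _ cg) => z sz.
  by apply: gh; rewrite inE.
- apply: PhiE; rewrite -[X in calc _ X](horner_algX y).
  by apply: calc_ext (calc_poly 'X) => z _; rewrite hornerX.
- apply: PhiE; rewrite -[X in calc _ X](rmorph1 ev).
  by apply: calc_ext (calc_poly 1) => z _; rewrite hornerC.
- by move=> g h cg ch; apply/PhiE/calcD; exact: PhiP.
(* Scaling by [c] is multiplication by a constant function. *)
- move=> c g cg; apply: PhiE; rewrite -mulr_algl -(horner_algC y).
  apply: (calcM (fun=> c) g _ _ _ (PhiP _ cg)).
  by apply: calc_ext (calc_poly c%:P) => z _; rewrite hornerC.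
- by move=> g h cg ch; apply/PhiE/calcM; exact: PhiP.
- by move=> g cg; apply/PhiE/calc_star; exact: PhiP.
Qed.

End FunctionalCalculus.

(** Since a functional calculus exists, the value chosen by [cfc] comes from a genuine one and is
    not the default [0]. *)
Lemma cfcP {R : realType} {A : cstarAlgType R} (y : A) (g : R[i] -> R[i]) :
  star y = y -> exists2 Phi, functional_calculus y Phi & cfc y g = Phi g.
Proof.
move=> /functional_calculus_exists[Phi hPhi].
apply: (xgetPex 0 (P := [set b | exists2 P, functional_calculus y P & b = P g])).
by exists (Phi g), Phi.
Qed.

(** * The inequality for Orlicz functions *)

Section OrliczNumericalRadius.
Context {R : realType} {A : cstarAlgType R} (phi : R -> R).
Hypothesis phi_orlicz : orlicz phi.
Implicit Types (x y w : A) (f : {linear A -> R[i]^o}).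

Let phi_max0 t : 0 <= t -> phi (Num.max 0 t) = phi t.
Proof. by move=> t0; rewrite max_r. Qed.

Lemma orlicz_state_jensen f y : states f -> positive y ->
  phi (complex.Re (f y)) <= complex.Re (f (cfc_nonneg y phi)).
Proof.
move=> fS y0; have sy := positive_star _ y0.
rewrite /cfc_nonneg.
have [Phi hPhi ->] := cfcP y (fun z => (phi (Num.max 0 (complex.Re z)))%:C) sy.
have [[_ f0] _] := fS; rewrite -phi_max0; last first.
  by case: y0 => z ->; exact: Re_positive_functional_ge0.
apply: (state_jensen y Phi f (fun t => phi (Num.max 0 t))) => //.
- exact: orlicz_max0_convex.
- exact: orlicz_max0_continuous.
Qed.

(** If the claim failed, continuity at [num_radius x] would give a state with nearly maximal value
    that violates the bound [M]. *)
Lemma orlicz_num_radius_sqr_le x (M : R) : 0 <= M ->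
  (forall f, states f -> phi (cabs (f x) ^+ 2) <= M) ->
  phi (num_radius x ^+ 2) <= M.
Proof.
move=> M0 hM; have v0 := num_radius_ge0 x.
(* This case includes that of an empty set of states. *)
have [->|vN0] := eqVneq (num_radius x) 0.
  by rewrite expr0n (orlicz0 phi_orlicz).
have vp : 0 < num_radius x by rewrite lt_def vN0.
rewrite leNgt; apply/negP => lt_M.
pose psi t := phi (Num.max 0 (t ^+ 2)).
have cpsi : continuous psi.
  rewrite (_ : psi = (fun t => phi (Num.max 0 t)) \o (fun t => t ^+ 2)) // => t.
  by apply: continuous_comp; [exact: exprn_continuous|exact: orlicz_max0_continuous].
have e0 : 0 < phi (num_radius x ^+ 2) - M by rewrite subr_gt0.
have /cvgrPdist_lt/(_ _ e0)/nbhs_ballP[d d0 H] := cpsi (num_radius x).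
have [f fS hf] := num_radius_adherent x d vp d0.
have := H (cabs (f x)); rewrite -ball_normE /= ger0_norm; last first.
  by rewrite subr_ge0 num_radius_ubound.
have near_v : num_radius x - cabs (f x) < d by lra.
move=> /(_ near_v); rewrite /psi !phi_max0 ?sqr_ge0 //.
move=> /(le_lt_trans (ler_norm _)); have := hM f fS; lra.
Qed.

(** Convexity is used twice, with weights [alpha / 2] and [1 - alpha / 2] and then inside the second
    term; Jensen's inequality for [f] and contractivity of states finish. *)
Lemma orlicz_num_radius_le (alpha : R) x w : 0 <= alpha <= 1 ->
  (forall f, states f -> cabs (f x) ^+ 2 <= alpha / 2 * cabs (f (x ^+ 2))
    + (alpha / 4 * complex.Re (f (w * star w))
       + (1 - 3 * alpha / 4) * complex.Re (f (star w * w)))) ->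
  phi (num_radius x ^+ 2) <= alpha / 2 * phi (num_radius (x ^+ 2))
    + cnorm ((alpha / 4)%:C *: cfc_nonneg (w * star w) phi
             + (1 - 3 * alpha / 4)%:C *: cfc_nonneg (star w * w) phi).
Proof.
move=> /andP[al0 al1] hx; have v0 := num_radius_ge0 (x ^+ 2).
have al2 : 0 <= alpha / 2 by lra.
have al4 : 0 <= alpha / 4 by lra.
have al34 : 0 <= 1 - 3 * alpha / 4 by lra.
apply: orlicz_num_radius_sqr_le => [|f fS].
  by rewrite addr_ge0 ?mulr_ge0 ?cnorm_ge0 ?(orlicz_ge0 phi_orlicz).
have [[_ f0] _] := fS.
have pos1 : positive (w * star w) by exists (star w); rewrite starK.
have pos2 : positive (star w * w) by exists w.
have J1 := orlicz_state_jensen f _ fS pos1.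
have J2 := orlicz_state_jensen f _ fS pos2.
have r1 : 0 <= complex.Re (f (w * star w)).
  by rewrite -{1}[w]starK; exact: Re_positive_functional_ge0.
have r2 := Re_positive_functional_ge0 f f0 w.
have n0 := cabs_ge0 (f (x ^+ 2)).
have nv := num_radius_ubound f (x ^+ 2) fS.
have cvx := orlicz_max0_convex phi phi_orlicz.
have bound := Re_functional_le f (alpha / 4) (1 - 3 * alpha / 4)
  (cfc_nonneg (w * star w) phi) (cfc_nonneg (star w * w) phi).
have fle := le_trans bound (state_le_norm f fS _).
have homo := orlicz_homo phi_orlicz.
have K1 : phi (cabs (f (x ^+ 2))) <= phi (num_radius (x ^+ 2)) by exact: homo.
move: (hx f fS) fle J1 J2 r1 r2 n0 K1.
move: (cabs (f (x ^+ 2))) (complex.Re (f (w * star w))) (complex.Re (f (star w * w))).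
move=> n P Q hfx fle J1 J2 P0 Q0 n0 K1.
apply: le_trans (homo _ _ (sqr_ge0 _) hfx) _.
(* The weights of [P] and [Q] add up to [1 - alpha / 2], which is at least [1 / 2]; dividing by it
   makes [Z] a convex combination. *)
pose Z := (1 - alpha / 2)^-1 * (alpha / 4 * P + (1 - 3 * alpha / 4) * Q).
have al12 : 0 < 1 - alpha / 2 by lra.
pose l := (alpha / 4) / (1 - alpha / 2).
have lE : 1 - l = (1 - 3 * alpha / 4) / (1 - alpha / 2).
  by rewrite /l; field; lra.
have l01 : 0 <= l <= 1.
  rewrite /l ler_pdivrMr // divr_ge0 ?(ltW al12) //=; lra.
have Z0 : 0 <= Z.
  by rewrite mulr_ge0 ?invr_ge0 ?(ltW al12) // addr_ge0 ?mulr_ge0.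
have ZE : Z = l * P + (1 - l) * Q by rewrite lE /Z /l; field; lra.
have h1 : phi Z <= l * phi P + (1 - l) * phi Q.
  by rewrite -(phi_max0 Z) // -(phi_max0 P) // -(phi_max0 Q) // ZE; exact: cvx.
have h2 : phi (alpha / 2 * n + (alpha / 4 * P + (1 - 3 * alpha / 4) * Q))
    <= alpha / 2 * phi n + (1 - alpha / 2) * phi Z.
  have E : alpha / 2 * n + (alpha / 4 * P + (1 - 3 * alpha / 4) * Q)
      = alpha / 2 * n + (1 - alpha / 2) * Z by rewrite /Z; field; lra.
  have s0 : 0 <= alpha / 2 * n + (1 - alpha / 2) * Z.
    by apply: addr_ge0; apply: mulr_ge0 => //; exact: ltW.
  rewrite E -(phi_max0 _ s0) -(phi_max0 n) // -(phi_max0 Z) //; apply: cvx; lra.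
apply: le_trans h2 _.
have h3 : (1 - alpha / 2) * phi Z <= alpha / 4 * phi P + (1 - 3 * alpha / 4) * phi Q.
  apply: le_trans (ler_wpM2l (ltW al12) h1) _; rewrite lE /l le_eqVlt.
  by apply/orP; left; apply/eqP; field; lra.
apply: lerD; first exact: ler_wpM2l.
apply: le_trans h3 _; apply: le_trans fle.
by apply: lerD; apply: ler_wpM2l.
Qed.

(** The bound for one state is used with [e = 1]; [x] and [star x] trade places in the second half,
    which only conjugates values of [f]. *)
Lemma orlicz_num_radius_buzano (alpha : R) x : 0 <= alpha <= 1 ->
  phi (num_radius x ^+ 2) <= alpha / 2 * phi (num_radius (x ^+ 2))
    + cnorm ((alpha / 4)%:C *: cfc_nonneg (x * star x) phi
             + (1 - 3 * alpha / 4)%:C *: cfc_nonneg (star x * x) phi) /\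
  phi (num_radius x ^+ 2) <= alpha / 2 * phi (num_radius (x ^+ 2))
    + cnorm ((alpha / 4)%:C *: cfc_nonneg (star x * x) phi
             + (1 - 3 * alpha / 4)%:C *: cfc_nonneg (x * star x) phi).
Proof.
move=> al; split.
- apply: orlicz_num_radius_le => // f [[_ f0] f1].
  have := sqr_functional_le f f0 alpha 1 x (star x) al.
  by rewrite star1 !mul1r starK mulr1 expr2 => /(_ f1 erefl).
- have := orlicz_num_radius_le alpha x (star x) al; rewrite starK; apply => f [[_ f0] f1].
  have := sqr_functional_le f f0 alpha 1 (star x) x al.
  rewrite star1 !mul1r starK mulr1 => /(_ f1 erefl).
  by rewrite -starM !positive_functional_star // !cabs_conj expr2.
Qed.

End OrliczNumericalRadius.

Theorem theorem2p20 (R : realType) (A : cstarAlgType R) (a : A) (alpha : R)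
    (ha : positive a) (ha0 : a <> 0) (halpha : 0 <= alpha <= 1) :
  (forall x xs : A, a_adjointable a x -> a_adjoint a x xs ->
    (a_num_radius a x ^+ 2
      <= (alpha / 2)%:E * a_num_radius a (x ^+ 2)%R
         + a_norm a ((alpha / 4)%:C *: (x * xs)
                     + (1 - 3 * alpha / 4)%:C *: (xs * x))%R)%E /\
    (a_num_radius a x ^+ 2
      <= (alpha / 2)%:E * a_num_radius a (x ^+ 2)%R
         + a_norm a ((alpha / 4)%:C *: (xs * x)
                     + (1 - 3 * alpha / 4)%:C *: (x * xs))%R)%E) /\
  (forall (x : A) (phi : R -> R), orlicz phi ->
    phi (num_radius x ^+ 2) <= alpha / 2 * phi (num_radius (x ^+ 2))
      + cnorm ((alpha / 4)%:C *: cfc_nonneg (x * star x) phi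
               + (1 - 3 * alpha / 4)%:C *: cfc_nonneg (star x * x) phi) /\
    phi (num_radius x ^+ 2) <= alpha / 2 * phi (num_radius (x ^+ 2))
      + cnorm ((alpha / 4)%:C *: cfc_nonneg (star x * x) phi
               + (1 - 3 * alpha / 4)%:C *: cfc_nonneg (x * star x) phi)).
Proof.
split=> [x xs _ axs|x phi phi_orlicz].
  exact: a_num_radius_buzano.
exact: orlicz_num_radius_buzano.
Qed.
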